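(* Let $\{\underline{X}_t\}_{t\in\mathbb{Z}}$ be a centred real $p$-dimensional time series whose covariance operator satisfies $0<\lambda_{\inf}\le\lambda_{\sup}<\infty$, let $D=(D_{a,b})_{1\le a,b\le p}$ be the associated operator built from the projection coefficients, and let $K_{a,b}(\omega,\lambda)$ be the integral kernel associated with $F^*D_{a,b}F$. Then: (i) for $a\ne b$: $\{X^{(a)}_t\}$ and $\{X_t^{(b)}\}$ are conditionally noncorrelated if and only if $K_{a,b}(\omega,\lambda)\equiv0$ for all $\omega,\lambda\in[0,2\pi]$; (ii) $\{X_t^{(a)}\}$ is conditionally stationary if and only if the integral kernel $K_{a,a}(\omega,\lambda)$ is diagonal; (iii) for $a\ne b$: the edge $(a,b)$ is conditionally time-invariant if and only if the integral kernel $K_{a,b}(\omega,\lambda)$ is diagonal.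
   Context: Fix $p\ge1$. $\{\underline{X}_t\}_{t\in\mathbb{Z}}$, $\underline{X}_t=(X_t^{(1)},\dots,X_t^{(p)})'$, is a real-valued time series with mean zero and finite variances on a probability space; ${\bf C}_{t,\tau}=\mathrm{Cov}(\underline{X}_t,\underline{X}_\tau)$ is $p\times p$, with $\sup_t\|{\bf C}_{t,t}\|_\infty<\infty$ ($\|\cdot\|_\infty$ = largest absolute entry). $\ell_2$ is the Hilbert space of square-summable complex sequences indexed by $\mathbb{Z}$, and $\ell_{2,p}$ the Hilbert space of $v=\mathrm{vec}[u^{(1)},\dots,u^{(p)}]$ with $u^{(s)}\in\ell_2$, with inner product the sum of the $\ell_2$ inner products. $C=(C_{a,b})_{1\le a,b\le p}$ is the infinite block matrix with $[C_{a,b}]_{t,\tau}=[{\bf C}_{t,\tau}]_{a,b}$, acting on $\ell_{2,p}$ by matrix multiplication; $\lambda_{\sup}=\sup_{\|v\|_2=1}\langle v,Cv\rangle$ and $\lambda_{\inf}=\inf_{\|v\|_2=1}\langle v,Cv\rangle$ over $v\in\ell_{2,p}$. $\mathcal{H}$ is the closed linear span (in the $L^2$ space with inner product $\mathrm{Cov}$) of all $X_t^{(c)}$, $t\in\mathbb{Z}$, $1\le c\le p$; $P_{\mathcal{M}}$ is the orthogonal projection onto a closed subspace $\mathcal{M}$; $\mathcal{H}-X_t^{(a)}$ is the closed span of all $X_s^{(c)}$ with $(s,c)\ne(t,a)$. When $0<\lambda_{\inf}\le\lambda_{\sup}<\infty$ there are unique coefficients with $P_{\mathcal{H}-X_t^{(a)}}(X_t^{(a)})=\sum_{\tau\in\mathbb{Z}}\sum_{b=1}^p\beta_{(\tau,b)\to(t,a)}X_\tau^{(b)}$,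 $\beta_{(t,a)\to(t,a)}=0$; put $\sigma_{a,t}^2=\mathrm{E}[X_t^{(a)}-P_{\mathcal{H}-X_t^{(a)}}(X_t^{(a)})]^2$. Define $[D_{a,b}]_{t,\tau}=1/\sigma_{a,t}^2$ if $(a,t)=(b,\tau)$, and $[D_{a,b}]_{t,\tau}=-\beta_{(\tau,b)\to(t,a)}/\sigma^2_{a,t}$ otherwise; $D=(D_{a,b})$. Definitions: an infinite matrix $A$ is Toeplitz if $A_{t,\tau}=a_{t-\tau}$ for some sequence $(a_r)_{r\in\mathbb{Z}}$. For $a\ne b$, $\{X_t^{(a)}\}$ and $\{X_t^{(b)}\}$ are conditionally noncorrelated if $D_{a,b}=0$; $\{X_t^{(a)}\}$ is conditionally stationary if $D_{a,a}$ is Toeplitz; for $a\ne b$ the edge $(a,b)$ is conditionally time-invariant if $D_{a,b}$ is Toeplitz. Fourier maps: $F:L_2[0,2\pi)\to\ell_2$, $[F(g)]_j=\frac1{2\pi}\int_0^{2\pi}g(\lambda)e^{ij\lambda}d\lambda$, and $F^*:\ell_2\to L_2[0,2\pi)$, $F^*(v)(\omega)=\sum_jv_je^{-ij\omega}$ (mutually inverse isomorphisms). For a bounded operator $A$ on $\ell_2$, $F^*AF$ is written formally as $(F^*AFg)(\omega)=\frac1{2\pi}\int_0^{2\pi}A(\omega,\lambda)g(\lambda)d\lambda$ with formal integral kernel $A(\omega,\lambda)=\sum_{t,\tau}A_{t,\tau}e^{-it\omega+i\tau\lambda}$. The kernel is only a formal (possibly singular) object: ''$A(\omega,\lambda)\equiv0$''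 means $F^*AF=0$, and ''the kernel is diagonal'', i.e. of the form $\delta_{\omega,\lambda}A(\omega)$ with $\delta$ the Dirac delta and $A(\cdot)\in L_2[0,2\pi)$, means that $(F^*AFg)(\omega)=A(\omega)g(\omega)$ for a.e. $\omega$, for all $g\in L_2[0,2\pi)$. *)

(* Defs.v *)
From HB Require Import structures.
From mathcomp Require Import all_boot all_order all_algebra.
From mathcomp Require Import all_classical all_reals all_analysis.
From mathcomp Require Import complex.

Set Implicit Arguments.
Unset Strict Implicit.
Unset Printing Implicit Defensive.

Import Order.TTheory GRing.Theory Num.Theory.
Import numFieldNormedType.Exports.

Local Open Scope classical_set_scope.
Local Open Scope ring_scope.
Local Open Scope complex_scope.

(* Sums over Z are limits of the symmetric partial sums over -n <= j <= n.
   As usual for [lim], [zsum] has no meaning when the series diverges. *)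
Definition zpsum (V : zmodType) (f : int -> V) (n : nat) : V :=
  \sum_(k < n.*2.+1) f (k%:Z - n%:Z).

Definition zsumR (R : realType) (f : int -> R) : R := limn (zpsum f).

Definition zsum (R : realType) (f : int -> R[i]) : R[i] :=
  zsumR (fun j => complex.Re (f j)) +i* zsumR (fun j => complex.Im (f j)).

Definition sqnorm_ell2 (R : realType) (v : int -> R[i]) : \bar R :=
  \esum_(j in [set: int]) ((Normc.normc (v j)) ^+ 2)%:E.

Definition ell2 (R : realType) : set (int -> R[i]) :=
  [set v | (sqnorm_ell2 v < +oo)%E].

Definition dot_ell2 (R : realType) (u v : int -> R[i]) : R[i] :=
  zsum (fun j => u j * (v j)^*).

(* An element vec[u^(1), ..., u^(p)] of l_{2,p} is the family of its blocks. *)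
Definition ell2p (R : realType) (p : nat) : set ('I_p -> int -> R[i]) :=
  [set v | forall s, ell2 (v s)].

Definition sqnorm_ell2p (R : realType) (p : nat) (v : 'I_p -> int -> R[i]) :
  \bar R := (\sum_(s < p) sqnorm_ell2 (v s))%E.

Definition dot_ell2p (R : realType) (p : nat) (u v : 'I_p -> int -> R[i]) :
  R[i] := \sum_(s < p) dot_ell2 (u s) (v s).

Definition cplx_imx (R : realType) (A : int -> int -> R) : int -> int -> R[i] :=
  fun t tau => (A t tau)%:C.

Definition imx_mul (R : realType) (A : int -> int -> R[i]) (v : int -> R[i]) :
  int -> R[i] := fun t => zsum (fun tau => A t tau * v tau).

Definition block_mul (R : realType) (p : nat)
    (A : 'I_p -> 'I_p -> int -> int -> R[i]) (v : 'I_p -> int -> R[i]) :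
  'I_p -> int -> R[i] := fun a t => \sum_(b < p) imx_mul (A a b) (v b) t.

(* The values <v, Av>, |v| = 1. For a real symmetric A they are real; [Re] only
   casts. When v has finite support every series involved is a finite sum, so
   that bounds on this set make A a bounded operator, for which all the series
   converge. *)
Definition unit_quadratic_values (R : realType) (p : nat)
    (A : 'I_p -> 'I_p -> int -> int -> R) : set (\bar R) :=
  [set (complex.Re (dot_ell2p v (block_mul (fun a b => cplx_imx (A a b)) v)))%:E
    | v in [set v | ell2p v /\ sqnorm_ell2p v = 1%E]].

Definition lambda_sup (R : realType) (p : nat)
    (A : 'I_p -> 'I_p -> int -> int -> R) : \bar R :=
  ereal_sup (unit_quadratic_values A).

Definition lambda_inf (R : realType) (p : nat)
    (A : 'I_p -> 'I_p -> int -> int -> R) : \bar R :=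
  ereal_inf (unit_quadratic_values A).

Section TimeSeries.
Context {d : measure_display} {Omega : measurableType d} {R : realType}.
Variable P : probability Omega R.

Definition centredL2 : set (Omega -> R) :=
  [set Y | Y \in Lfun P 2%:E /\ ('E_P[Y] = 0)%E].

Definition closed_span (I : choiceType) (Y : I -> Omega -> R) (J : set I) :
    set (Omega -> R) :=
  [set Z | centredL2 Z /\ forall e : R, 0 < e ->
    exists s : seq (R * I), (forall q, q \in s -> J q.2) /\
      ('V_P[fun w => (Z w - \sum_(q <- s) q.1 * Y q.2 w)%R] < e%:E)%E].

Definition is_projection (M : set (Omega -> R)) (Y Z : Omega -> R) : Prop :=
  M Z /\ forall W, M W -> covariance P (Y \- Z) W = 0%E.

Variables (p : nat) (X : int -> 'I_p -> Omega -> R).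

Definition covmx (t tau : int) : 'M[R]_p :=
  \matrix_(a, b) fine (covariance P (X t a) (X tau b)).

Definition cov_block (a b : 'I_p) (t tau : int) : R := covmx t tau a b.

Definition span_without (t : int) (a : 'I_p) : set (Omega -> R) :=
  closed_span (fun k : int * 'I_p => X k.1 k.2) [set k | k != (t, a)].

(* [PX t a] is the projection of X_t^(a) on H - X_t^(a), and
   [beta tau b t a] is beta_{(tau,b) -> (t,a)}; the series converges in L^2. *)
Definition projection_coefficients (PX : int -> 'I_p -> Omega -> R)
    (beta : int -> 'I_p -> int -> 'I_p -> R) : Prop :=
  forall t a,
    [/\ is_projection (span_without t a) (X t a) (PX t a),
        beta t a t a = 0 &
        (fun n : nat => 'V_P[fun w => (PX t a w -
          zpsum (fun tau => \sum_(b < p) beta tau b t a * X tau b w) n)%R]%E)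
          @ \oo --> 0%E].

Definition residual_variance (PX : int -> 'I_p -> Omega -> R)
    (a : 'I_p) (t : int) : R :=
  fine 'E_P[((X t a \- PX t a) ^+ 2)%R]%E.

Definition Dblock (PX : int -> 'I_p -> Omega -> R)
    (beta : int -> 'I_p -> int -> 'I_p -> R)
    (a b : 'I_p) (t tau : int) : R :=
  if (a, t) == (b, tau) then (residual_variance PX a t)^-1
  else - beta tau b t a / residual_variance PX a t.

End TimeSeries.

Definition Toeplitz (T : Type) (A : int -> int -> T) : Prop :=
  exists r : int -> T, forall t tau, A t tau = r (t - tau).

Definition conditionally_noncorrelated (R : realType) (p : nat)
    (D : 'I_p -> 'I_p -> int -> int -> R) (a b : 'I_p) : Prop :=
  forall t tau, D a b t tau = 0.

Definition conditionally_stationary (R : realType) (p : nat)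
    (D : 'I_p -> 'I_p -> int -> int -> R) (a : 'I_p) : Prop :=
  Toeplitz (D a a).

Definition conditionally_time_invariant (R : realType) (p : nat)
    (D : 'I_p -> 'I_p -> int -> int -> R) (a b : 'I_p) : Prop :=
  Toeplitz (D a b).

Section Fourier.
Context {R : realType}.
Local Notation mu := (@lebesgue_measure R).

Definition circle : set R := `[0, 2 * pi[%classic.

Definition cis (x : R) : R[i] := cos x +i* sin x.

(* Functions are total on R; only their values on [0, 2pi) matter, and up to
   a.e. equality there. *)
Definition sqnorm_L2 (g : R -> R[i]) : \bar R :=
  (\int[mu]_(x in circle) ((Normc.normc (g x)) ^+ 2)%:E)%E.

Definition L2 : set (R -> R[i]) :=
  [set g | [/\ measurable_fun circle (fun x => complex.Re (g x)),
               measurable_fun circle (fun x => complex.Im (g x)) &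
               (sqnorm_L2 g < +oo)%E]].

Definition integralC (g : R -> R[i]) : R[i] :=
  (\int[mu]_(x in circle) complex.Re (g x)) +i*
  (\int[mu]_(x in circle) complex.Im (g x)).

Definition fourier (g : R -> R[i]) (j : int) : R[i] :=
  ((2 * pi)^-1)%:C * integralC (fun x => g x * cis (j%:~R * x)).

(* [is_Fstar v h]: h is a representative of F^*(v) *)
Definition is_Fstar (v : int -> R[i]) (h : R -> R[i]) : Prop :=
  [/\ ell2 v, L2 h &
      (fun n : nat => sqnorm_L2 (fun x =>
         h x - zpsum (fun j => v j * cis (- (j%:~R * x))) n)) @ \oo --> 0%E].

Definition is_FstarAF (A : int -> int -> R[i]) (g h : R -> R[i]) : Prop :=
  is_Fstar (imx_mul A (fourier g)) h.

(* The kernel of F^* A F is a formal object, and is treated through the operator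
   it stands for. *)
Definition kernel_zero (A : int -> int -> R[i]) : Prop :=
  forall g, L2 g -> exists2 h, is_FstarAF A g h & ae_eq mu circle h (fun=> 0).

Definition kernel_diagonal (A : int -> int -> R[i]) : Prop :=
  exists2 m, L2 m &
  forall g, L2 g ->
    exists2 h, is_FstarAF A g h & ae_eq mu circle h (fun x => m x * g x).

End Fourier.

(* Main.v *)
Require Import Defs.
From HB Require Import structures.
From mathcomp Require Import all_boot all_order all_algebra.
From mathcomp Require Import all_classical all_reals all_analysis.
From mathcomp Require Import complex measurable_realfun zify ring lra.

Set Implicit Arguments.
Unset Strict Implicit.
Unset Printing Implicit Defensive.

Import Order.TTheory GRing.Theory Num.Theory.
Import numFieldNormedType.Exports.

Local Open Scope classical_set_scope.
Local Open Scope ring_scope.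

(** A matrix [A] with operator [F^* A F] can be read off the exponentials: the
    image of [exp (- i tau x)] is the function whose Fourier coefficients are the
    entries of the column [tau]. Hence a zero kernel means a zero matrix
    ([kernel_zeroP]), and if [F^* A F] is the multiplication by [m], then
    [A t tau] is the coefficient of [m] at [t - tau], so [A] is Toeplitz
    ([kernel_diagonal_Toeplitz]).

    The converse is the substantial part ([Toeplitz_kernel_diagonal]). If
    [A t tau = r (t - tau)], the only candidate for the symbol is the function
    [m] with coefficients [r], and the product of [A] with the coefficients of
    [g] is a convolution, which is the sequence of coefficients of [m * g]. For
    this to be meaningful in L2, the sequence [r] and that convolution must be
    square-summable, which holds as soon as [A] is bounded. Three facts on Fourier
    series are needed: Bessel's inequality ([bessel]), the Riesz-Fischer theorem
    ([Fstar_exists]), and the uniqueness theorem for integrable functions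
    ([fourier_inj0]), which is applied to [m * g], a product of two
    square-integrable functions. For uniqueness, the vanishing of the
    coefficients is preserved by multiplication with trigonometric polynomials,
    and explicit polynomials of this kind converge boundedly to the indicator
    function of the complement of a short interval; so the integral over every
    short interval vanishes.

    The blocks of [D] are bounded because [D] is the inverse of the covariance
    operator ([Dblock_bounded]). The residuals of the projections, divided by
    their variances, form a system biorthogonal to the variables; its expansion
    in the variables has the rows of [D] as coefficients, so [D] is its Gram
    matrix. The lower bound [lambda_inf] of the covariance then bounds the norm of [D]
    by [lambda_inf^-1] ([gram_bound]). *)

(** * Sums over symmetric windows of integers *)

(** The index set of [zpsum] as a duplicate-free sequence, so that the whole
    theory of big operators over sequences applies. *)
Definition window (n : nat) : seq int :=
  [seq k%:Z - n%:Z | k <- iota 0 n.*2.+1].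

Lemma zpsum_window (V : zmodType) (f : int -> V) n :
  zpsum f n = \sum_(j <- window n) f j.
Proof. rewrite /window big_map /zpsum.
by rewrite -(big_mkord xpredT (fun k => f (k%:Z - n%:Z))) /index_iota subn0. Qed.

Lemma mem_window j n : (j \in window n) = (`|j| <= n)%N.
Proof.
apply/mapP/idP => [[k]|jn]; first by rewrite mem_iota => /andP[_ kn] ->; lia.
by exists (absz (j + n%:Z)); [rewrite mem_iota; lia|lia].
Qed.

Lemma window_uniq n : uniq (window n).
Proof. by rewrite map_inj_uniq ?iota_uniq// => k l; lia. Qed.

Lemma zpsum0 (V : zmodType) (f : int -> V) : zpsum f 0 = f 0.
Proof. by rewrite /zpsum big_ord1 subrr. Qed.

Lemma zpsumS (V : zmodType) (f : int -> V) n :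
  zpsum f n.+1 = f (- n.+1%:Z) + zpsum f n + f n.+1%:Z.
Proof.
rewrite /zpsum doubleS big_ord_recl big_ord_recr /= addrA sub0r.
congr (_ + _ + f _); last by rewrite /bump /=; lia.
by apply: eq_bigr => k _; congr f; rewrite /bump /=; lia.
Qed.

Lemma eq_zpsum (V : zmodType) (f g : int -> V) n :
  (forall j, (`|j| <= n)%N -> f j = g j) -> zpsum f n = zpsum g n.
Proof.
move=> fg; rewrite !zpsum_window; apply: eq_big_seq => j.
by rewrite mem_window; exact: fg.
Qed.

Lemma zpsum_eq0 (V : zmodType) (f : int -> V) n :
  (forall j, f j = 0) -> zpsum f n = 0.
Proof. by move=> f0; rewrite zpsum_window big1. Qed.

Lemma zpsumD (V : zmodType) (f g : int -> V) n :
  zpsum (fun j => f j + g j) n = zpsum f n + zpsum g n.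
Proof. by rewrite !zpsum_window big_split. Qed.

Lemma zpsumB (V : zmodType) (f g : int -> V) n :
  zpsum (fun j => f j - g j) n = zpsum f n - zpsum g n.
Proof. by rewrite !zpsum_window sumrB. Qed.

Lemma zpsumMl (V : pzRingType) (f : int -> V) a n :
  zpsum (fun j => a * f j) n = a * zpsum f n.
Proof. by rewrite !zpsum_window big_distrr. Qed.

Lemma raddf_zpsum (V W : zmodType) (h : {additive V -> W}) (f : int -> V) n :
  h (zpsum f n) = zpsum (h \o f) n.
Proof. by rewrite !zpsum_window raddf_sum. Qed.

Lemma zpsum_supp (V : zmodType) (f : int -> V) N n :
  (forall j, (N < `|j|)%N -> f j = 0) -> (N <= n)%N -> zpsum f n = zpsum f N.
Proof.
move=> f0; elim: n => [|n IH]; first by rewrite leqn0 => /eqP->.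
rewrite leq_eqVlt => /predU1P[->//|Nn].
by rewrite zpsumS IH// f0 ?f0 ?add0r ?addr0//; lia.
Qed.

Lemma zpsum_delta (V : zmodType) (f : int -> V) i n :
  (forall j, j != i -> f j = 0) -> (`|i| <= n)%N -> zpsum f n = f i.
Proof.
move=> f0 iN; rewrite zpsum_window (bigD1_seq i) ?mem_window ?window_uniq//=.
by rewrite big1 ?addr0.
Qed.

Lemma zpsum_ge0 (R : numDomainType) (f : int -> R) n :
  (forall j, 0 <= f j) -> 0 <= zpsum f n.
Proof. by move=> f0; rewrite zpsum_window sumr_ge0. Qed.

Lemma le_zpsum (R : numDomainType) (f g : int -> R) n :
  (forall j, f j <= g j) -> zpsum f n <= zpsum g n.
Proof. by move=> f0; rewrite !zpsum_window ler_sum. Qed.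

Lemma zpsum_mono (R : numDomainType) (f : int -> R) m n :
  (forall j, 0 <= f j) -> (m <= n)%N -> zpsum f m <= zpsum f n.
Proof.
move=> f0; elim: n => [|n IH]; first by rewrite leqn0 => /eqP->.
rewrite leq_eqVlt => /predU1P[->//|mn]; apply: le_trans (IH mn) _.
by rewrite zpsumS addrAC lerDr addr_ge0.
Qed.

Lemma ler_sum_subset (R : numDomainType) (J : eqType) (s t : seq J)
    (f : J -> R) : uniq s -> uniq t -> {subset s <= t} ->
  (forall i, 0 <= f i) -> \sum_(i <- s) f i <= \sum_(i <- t) f i.
Proof.
move=> us ut st f0; rewrite [leRHS](bigID (mem s))/= -[X in _ <= X + _]big_filter.
rewrite [X in _ <= X + _](_ : _ = \sum_(i <- s) f i).
  by rewrite lerDl sumr_ge0.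
apply: perm_big; apply: uniq_perm => //; first exact: filter_uniq.
by move=> i; rewrite mem_filter andb_idr//; exact: st.
Qed.

(** * Gram matrices of biorthogonal systems *)

Section BiorthogonalSystem.
Variables (R : realType) (V : lmodType R) (B : V -> V -> R).
Hypothesis BDl : forall u v w, B (u + v) w = B u w + B v w.
Hypothesis BZl : forall a u w, B (a *: u) w = a * B u w.
Hypothesis BC : forall u v, B u v = B v u.
Hypothesis B_ge0 : forall u, 0 <= B u u.

Lemma form0l w : B 0 w = 0.
Proof. by rewrite -(scale0r 0) BZl mul0r. Qed.

Lemma formBl u v w : B (u - v) w = B u w - B v w.
Proof. by rewrite BDl -scaleN1r BZl mulN1r. Qed.

Lemma formBr u v w : B w (u - v) = B w u - B w v.
Proof. by rewrite BC formBl !(BC _ w). Qed.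

Lemma form_suml (J : Type) (s : seq J) (F : J -> V) w :
  B (\sum_(i <- s) F i) w = \sum_(i <- s) B (F i) w.
Proof.
elim: s => [|i s IH]; first by rewrite !big_nil form0l.
by rewrite !big_cons BDl IH.
Qed.

Lemma form_sumr (J : Type) (s : seq J) (F : J -> V) w :
  B w (\sum_(i <- s) F i) = \sum_(i <- s) B w (F i).
Proof. by rewrite BC form_suml; apply: eq_bigr => i _; rewrite BC. Qed.

Lemma formZr a u w : B w (a *: u) = a * B w u.
Proof. by rewrite BC BZl BC. Qed.

(** The Cauchy-Schwarz inequality for a semidefinite form: when [B v v] does not
    vanish, evaluate the form at [B v v *: u - B u v *: v]; when it does, the
    form is affine on the line [u - y *: v], so it stays nonnegative only if
    [B u v] vanishes too. *)
Lemma form_CS u v : B u v ^+ 2 <= B u u * B v v.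
Proof.
have key x y : 0 <= x ^+ 2 * B u u - 2 * x * y * B u v + y ^+ 2 * B v v.
  have := B_ge0 (x *: u - y *: v).
  rewrite !(formBl, formBr, BZl, formZr) (BC v u); lra.
have [v0|v0] := eqVneq (B v v) 0.
  have [->|uv0] := eqVneq (B u v) 0; first by rewrite v0 expr0n mulr0.
  have := key 1 ((B u u + 1) / (2 * B u v)); rewrite v0 mulr0 addr0.
  have -> : 2 * 1 * ((B u u + 1) / (2 * B u v)) * B u v = B u u + 1 by field.
  by have := B_ge0 u; lra.
have v_gt0 : 0 < B v v by rewrite lt_neqAle eq_sym v0 B_ge0.
have := key (B v v) (B u v).
have -> : B v v ^+ 2 * B u u - 2 * B v v * B u v * B u v + B u v ^+ 2 * B v v
        = B v v * (B u u * B v v - B u v ^+ 2) by ring.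
by rewrite pmulr_rge0// subr_ge0.
Qed.

Lemma form_cvg0_l (u : nat -> V) v :
  (fun n => B (u n) (u n)) @ \oo --> 0 -> (fun n => B (u n) v) @ \oo --> 0.
Proof.
move=> u0; suff : (fun n => B (u n) v ^+ 2) @ \oo --> 0.
  move=> h; apply: norm_cvg0.
  have -> : (fun n => `|B (u n) v|) = (fun n => Num.sqrt (B (u n) v ^+ 2)).
    by apply/funext => n; rewrite sqrtr_sqr.
  by rewrite -(@sqrtr0 R); apply: continuous_cvg => //; exact: sqrt_continuous.
apply: (@squeeze_cvgr _ _ _ _ (cst 0) (fun n => B (u n) (u n) * B v v)).
- by apply: nearW => n; rewrite sqr_ge0 form_CS.
- exact: cvg_cst.
- by rewrite -(mul0r (B v v)); apply: cvgMl.
Qed.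

(** By the parallelogram law [B (u + v) (u + v)] is at most twice
    [B u u + B v v]. *)
Lemma form_cvg0_D (u v : nat -> V) :
  (fun n => B (u n) (u n)) @ \oo --> 0 ->
  (fun n => B (v n) (v n)) @ \oo --> 0 ->
  (fun n => B (u n + v n) (u n + v n)) @ \oo --> 0.
Proof.
move=> u0 v0.
apply: (@squeeze_cvgr _ _ _ _ (cst 0)
   (fun n => (B (u n) (u n) + B (v n) (v n)) * 2)).
- apply: nearW => n; rewrite B_ge0/=.
  have := B_ge0 (u n - v n).
  rewrite formBl !formBr BDl 2!(BC _ (_ + _)) !BDl (BC (v n) (u n)); lra.
- exact: cvg_cst.
- rewrite (_ : 0 = (0 + 0) * 2); last by rewrite addr0 mul0r.
  by apply: cvgMl; apply: cvgD.
Qed.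

Lemma form_cvg0_Z a (u : nat -> V) :
  (fun n => B (u n) (u n)) @ \oo --> 0 ->
  (fun n => B (a *: u n) (a *: u n)) @ \oo --> 0.
Proof.
move=> u0.
rewrite [X in X @ _ --> _](_ : _ = (fun n => (a * a) * B (u n) (u n))); last first.
  by apply/funext => n; rewrite BZl formZr mulrA.
by rewrite -(mulr0 (a * a)); apply: cvgMr.
Qed.

Lemma form_cvg_norm (u : nat -> V) w :
  (fun n => B (w - u n) (w - u n)) @ \oo --> 0 ->
  (fun n => B (u n) (u n)) @ \oo --> B w w.
Proof.
move=> u0; have uw := form_cvg0_l w u0.
rewrite [X in X @ _ --> _](_ : _ = (fun n => B (w - u n) (w - u n)
   - B (w - u n) w * 2 + B w w)); last first.
  apply/funext => n; rewrite !(formBl, formBr) (BC w (u n)); ring.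
rewrite -[X in _ --> X]add0r -(subrr 0) -{2}(mul0r 2).
by apply: cvgD; [apply: cvgB => //; exact: cvgMl|exact: cvg_cst].
Qed.

(** In what follows [X] and [Z] are biorthogonal, the rows of [D] are the
    coordinates of the [Z k] in the system [X], and [lam] is a lower bound of the
    Gram matrix of [X] on window sums. In a Hilbert space [D] would be the inverse
    of that Gram matrix; here its properties are derived from finite combinations
    and limits along the windows [W n]. *)
Variables (I : eqType) (W : nat -> seq I) (X Z : I -> V) (D : I -> I -> R).
Variable lam : R.
Hypothesis W_uniq : forall n, uniq (W n).
Hypothesis W_exhaust : forall i, \forall n \near \oo, i \in W n.
Hypothesis lam_gt0 : 0 < lam.
Hypothesis coercive : forall n (c : I -> R),
  lam * \sum_(i <- W n) c i ^+ 2 <=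
    B (\sum_(i <- W n) c i *: X i) (\sum_(i <- W n) c i *: X i).
Hypothesis biorthogonal : forall k l, B (X k) (Z l) = (k == l)%:R.
Hypothesis Z_expansion : forall k,
  (fun n => B (Z k - \sum_(l <- W n) D k l *: X l)
              (Z k - \sum_(l <- W n) D k l *: X l)) @ \oo --> 0.

Section Combination.
Variables (s : seq I) (c : I -> R).
Let U := \sum_(k <- s) c k *: Z k.
Let w l := \sum_(k <- s) c k * D k l.
Let Un n := \sum_(l <- W n) w l *: X l.

Lemma combination_expansion :
  (fun n => B (U - Un n) (U - Un n)) @ \oo --> 0.
Proof.
have UnE n : U - Un n = \sum_(k <- s) c k *: (Z k - \sum_(l <- W n) D k l *: X l).
  under [RHS]eq_bigr do rewrite scalerBr scaler_sumr.
  rewrite sumrB; congr (_ - _); rewrite exchange_big /=; apply: eq_bigr => l _.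
  by rewrite /w scaler_suml; apply: eq_bigr => k _; rewrite scalerA.
under eq_fun do rewrite UnE.
suff gen t : let E n := \sum_(k <- t) c k *: (Z k - \sum_(l <- W n) D k l *: X l)
  in (fun n => B (E n) (E n)) @ \oo --> 0 by exact: gen.
elim: t => [|k t IH] /=;
  first by under eq_fun do rewrite big_nil form0l; exact: cvg_cst.
under eq_fun do rewrite big_cons.
by apply: form_cvg0_D => //; exact: form_cvg0_Z.
Qed.

(** Pairing with [Z l] is continuous and picks out of the expansion [Un] the
    coefficient of [X l]. *)
Lemma form_combination l : B U (Z l) = w l.
Proof.
have h : (fun n => B (U - Un n) (Z l)) @ \oo --> B U (Z l) - w l.
  apply: cvg_near_cst; have := W_exhaust l; apply: filterS => n ln.
  rewrite formBl; congr (_ - _); rewrite form_suml (bigD1_seq l)//=.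
  rewrite BZl biorthogonal eqxx mulr1 big1 ?addr0// => i il.
  by rewrite BZl biorthogonal (negbTE il) mulr0.
have := form_cvg0_l (Z l) combination_expansion.
by move=> /(cvg_unique (@norm_hausdorff _ _) h)/eqP; rewrite subr_eq0 => /eqP.
Qed.

(** Coercivity on the window sums [Un m], which converge to [U], survives in
    the limit. *)
Lemma bessel_combination n : lam * \sum_(l <- W n) w l ^+ 2 <= B U U.
Proof.
have h := form_cvg_norm combination_expansion.
rewrite -(cvg_lim _ h)//; apply: limr_ge; first by apply/cvg_ex; exists (B U U).
have sub : \forall m \near \oo, {subset W n <= W m}.
  elim: (W n) => [|i t IH]; first exact: nearW.
  near=> m => j; rewrite inE => /predU1P[->|]; first by near: m; exact: W_exhaust.
  by move: j; near: m.
apply: filterS sub => m nm; apply: le_trans (coercive m _).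
by rewrite ler_pM2l// ler_sum_subset// => i; exact: sqr_ge0.
Unshelve. all: by end_near. Qed.

End Combination.

(** [D] is the Gram matrix of [Z]. *)
Let gram_sym k l : D k l = D l k.
Proof.
have h k' l' : B (Z k') (Z l') = D k' l'.
  have := @form_combination [:: k'] (fun=> 1) l'.
  by rewrite !big_seq1 scale1r mul1r.
by rewrite -!h BC.
Qed.

(** For [U = \sum c k *: Z k] and [w = D c], Bessel's inequality gives
    [lam * |w|^2 <= B U U], and [B U U] is the scalar product of [c] and [w];
    splitting that product by Young's inequality and using Bessel once more gives
    [B U U <= lam^-1 * |c|^2]. So the operator norm of [D] is at most [lam^-1]. *)
Lemma gram_bound m n (c : I -> R) :
  \sum_(l <- W m) (\sum_(k <- W n) D l k * c k) ^+ 2 <=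
    lam ^- 2 * \sum_(k <- W n) c k ^+ 2.
Proof.
set U := \sum_(k <- W n) c k *: Z k.
pose w l := \sum_(k <- W n) c k * D k l.
have wE l : \sum_(k <- W n) D l k * c k = w l.
  by apply: eq_bigr => k _; rewrite gram_sym mulrC.
under eq_bigr do rewrite wE.
have hm := bessel_combination (W n) c m; have hn := bessel_combination (W n) c n.
rewrite -/U -/w in hm hn.
have UE : B U U = \sum_(k <- W n) c k * w k.
  rewrite {2}/U form_sumr; apply: eq_bigr => k _.
  by rewrite formZr form_combination.
have UUc : B U U <= lam^-1 * \sum_(k <- W n) c k ^+ 2.
  have : B U U * 2 <= lam^-1 * (\sum_(k <- W n) c k ^+ 2) + B U U.
    apply: le_trans (_ : _ <= lam^-1 * (\sum_(k <- W n) c k ^+ 2) +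
       lam * \sum_(k <- W n) w k ^+ 2) _; last by rewrite lerD2l.
    rewrite UE mulr_suml !mulr_sumr -big_split/=; apply: ler_sum => k _.
    have := mulr_ge0 (ltW lam_gt0) (sqr_ge0 (lam^-1 * c k - w k)).
    have -> : lam * (lam^-1 * c k - w k) ^+ 2 =
      lam^-1 * c k ^+ 2 + lam * w k ^+ 2 - c k * w k * 2.
      by field; rewrite gt_eqF.
    by rewrite subr_ge0.
  lra.
rewrite -(ler_pM2l lam_gt0); apply: le_trans hm _; apply: le_trans UUc _.
by rewrite mulrA expr2 invfM mulrA mulfV ?gt_eqF// mul1r.
Qed.

End BiorthogonalSystem.

(** * Square-summable sequences and the quadratic form of a block matrix *)

Section Ell2.
Local Open Scope complex_scope.
Context {R : realType}.
Implicit Types (u v : int -> R[i]) (f c : int -> R).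

Lemma lim_zpsum_supp f N : (forall j, (N < `|j|)%N -> f j = 0) ->
  zsumR f = zpsum f N.
Proof.
move=> f0; apply: lim_near_cst => //; exists N => // n /= Nn.
exact: zpsum_supp.
Qed.

Lemma zsum_real f : zsum (fun j => (f j)%:C) = (zsumR f)%:C.
Proof.
rewrite /zsum /= /real_complex_def; congr (_ +i* _).
by rewrite (@lim_zpsum_supp _ 0) ?zpsum_eq0.
Qed.

Lemma dot_real f c :
  dot_ell2 (fun j => (f j)%:C) (fun j => (c j)%:C) =
  (zsumR (fun j => f j * c j))%:C.
Proof.
by rewrite -zsum_real /dot_ell2; congr zsum; apply/funext => j; simpc.
Qed.

Lemma zsum_delta u i : (forall j, j != i -> u j = 0) -> zsum u = u i.
Proof.
move=> u0; rewrite /zsum !(@lim_zpsum_supp _ `|i|).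
- by rewrite !(@zpsum_delta _ _ i)//; [case: (u i)|move=> j /u0->..].
- by move=> j ij; rewrite u0//; apply: contraTneq ij => ->; rewrite ltnn.
- by move=> j ij; rewrite u0//; apply: contraTneq ij => ->; rewrite ltnn.
Qed.

(** A polynomial form of the squared modulus, free of the square root in the
    complex norm. *)
Definition sqnormc (z : R[i]) : R := complex.Re z ^+ 2 + complex.Im z ^+ 2.

Lemma normc_sqr (z : R[i]) : Normc.normc z ^+ 2 = sqnormc z.
Proof. by case: z => a b; rewrite sqr_sqrtr// addr_ge0 ?sqr_ge0. Qed.

Lemma sqnormc_ge0 z : 0 <= sqnormc z.
Proof. by rewrite addr_ge0 ?sqr_ge0. Qed.

Lemma sqnormc_mul_conj (z : R[i]) : z * conjc z = (sqnormc z)%:C.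
Proof. by case: z => a b; rewrite /sqnormc; simpc => /=; congr (_ +i* _); ring. Qed.

Lemma zpsum_le_sqnorm v n :
  ((zpsum (fun j => sqnormc (v j)) n)%:E <= sqnorm_ell2 v)%E.
Proof.
apply: esum_ge; exists [set` window n]; first by split => //; exact: finite_seq.
rewrite -fsbig_seq ?window_uniq//= sumEFin zpsum_window.
by under [in leRHS]eq_bigr do rewrite normc_sqr.
Qed.

(** Every finite set of integers lies in some window, so the windows alone
    determine the sum over all finite subsets. *)
Lemma sqnorm_le v (K : R) :
  (forall n, zpsum (fun j => sqnormc (v j)) n <= K) ->
  (sqnorm_ell2 v <= K%:E)%E.
Proof.
move=> vK; apply: ge_ereal_sup => _ [A [/finite_seqP[s ->] _] <-].
pose t := undup s.
have -> : [set` s] = [set` t] by apply/seteqP; split => j /=; rewrite mem_undup.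
rewrite -fsbig_seq ?undup_uniq//= sumEFin lee_fin.
pose N := (\max_(j <- t) `|j|)%N.
apply: le_trans (vK N); rewrite zpsum_window.
under eq_bigr do rewrite normc_sqr.
apply: ler_sum_subset; rewrite ?undup_uniq ?window_uniq//; last first.
  by move=> j; exact: sqnormc_ge0.
by move=> j jt; rewrite mem_window /N (big_rem j)//= leq_maxl.
Qed.

Lemma ell2P v :
  ell2 v <-> exists K, forall n, zpsum (fun j => sqnormc (v j)) n <= K.
Proof.
split => [vy|[K vK]].
  exists (fine (sqnorm_ell2 v)) => n; rewrite -lee_fin fineK ?zpsum_le_sqnorm//.
  rewrite ge0_fin_numE//.
  by apply: esum_ge0 => j _; rewrite lee_fin sqr_ge0.
by rewrite /ell2 /=; apply: le_lt_trans (sqnorm_le vK) _; exact: ltry.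
Qed.

Lemma sqnorm_supp v N : (forall j, (N < `|j|)%N -> v j = 0) ->
  sqnorm_ell2 v = (zpsum (fun j => sqnormc (v j)) N)%:E.
Proof.
move=> v0; apply/eqP; rewrite eq_le zpsum_le_sqnorm andbT sqnorm_le// => n.
have s0 j : 0 <= sqnormc (v j) by exact: sqnormc_ge0.
have [nN|/ltnW Nn] := leqP n N; first exact: zpsum_mono.
by rewrite (zpsum_supp _ Nn)// => j /v0 ->; rewrite /sqnormc /= expr0n addr0.
Qed.

Section Quadratic.
Variables (p : nat) (A : 'I_p -> 'I_p -> int -> int -> R).

(** On finitely supported real vectors all the series in the quadratic form
    are finite sums. *)
Lemma quadratic_value (N : nat) (c : 'I_p -> int -> R) :
  (forall s j, (N < `|j|)%N -> c s j = 0) ->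
  let v := fun s j => (c s j)%:C in
  complex.Re (dot_ell2p v (block_mul (fun a b => cplx_imx (A a b)) v)) =
  \sum_(s < p) zpsum (fun t => c s t *
     \sum_(b < p) zpsum (fun tau => A s b t tau * c b tau) N) N.
Proof.
move=> c0 v.
have vE s : block_mul (fun a b => cplx_imx (A a b)) v s = fun t =>
    (\sum_(b < p) zpsum (fun tau => A s b t tau * c b tau) N)%:C.
  apply/funext => t; rewrite /block_mul rmorph_sum; apply: eq_bigr => b _.
  rewrite /imx_mul /cplx_imx.
  under [X in zsum X]eq_fun do rewrite /v -rmorphM.
  rewrite zsum_real (@lim_zpsum_supp _ N)// => j Nj.
  by rewrite c0 ?mulr0.
rewrite /dot_ell2p.
under eq_bigr do rewrite vE.
under eq_bigr do rewrite dot_real.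
rewrite -rmorph_sum/=; apply: eq_bigr => s _.
by apply: lim_zpsum_supp => j Nj; rewrite c0 ?mul0r.
Qed.

(** The infimum is taken over unit vectors; by homogeneity it bounds the form on
    every vector supported in a window. Such vectors are enough here, because the
    infinite-dimensional statements are obtained by limits. *)
Lemma lambda_inf_coercive (e : R) (N : nat) (c : 'I_p -> int -> R) :
  (e%:E <= lambda_inf A)%E ->
  e * \sum_(s < p) zpsum (fun t => c s t ^+ 2) N <=
  \sum_(s < p) zpsum (fun t => c s t *
     \sum_(b < p) zpsum (fun tau => A s b t tau * c b tau) N) N.
Proof.
move=> eA; set S := \sum_(s < p) zpsum _ N.
have S0 : 0 <= S.
  by apply: sumr_ge0 => s _; apply: zpsum_ge0 => j; exact: sqr_ge0.
have [Se|Sne] := eqVneq S 0.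
  have cz s t : (`|t| <= N)%N -> c s t = 0.
    move=> tN; apply/eqP; rewrite -sqrf_eq0 eq_le sqr_ge0 andbT -Se.
    apply: le_trans (_ : zpsum (fun t => c s t ^+ 2) N <= _).
      rewrite zpsum_window (bigD1_seq t) ?mem_window ?window_uniq//= lerDl.
      by apply: sumr_ge0 => *; exact: sqr_ge0.
    rewrite /S (bigD1 s)//= lerDl sumr_ge0// => i _.
    by apply: zpsum_ge0 => j; exact: sqr_ge0.
  rewrite Se mulr0 sumr_ge0// => s _.
  rewrite (@eq_zpsum _ _ (fun=> 0)) ?zpsum_eq0// => j jN.
  by rewrite cz ?mul0r.
have S_gt0 : 0 < S by rewrite lt_neqAle eq_sym Sne.
pose r := (Num.sqrt S)^-1.
have rr : r ^+ 2 = S^-1 by rewrite exprVn sqr_sqrtr.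
pose c' s j := if (`|j| <= N)%N then r * c s j else 0.
have c'0 s j : (N < `|j|)%N -> c' s j = 0 by rewrite /c' ltnNge => /negbTE ->.
have c'E s j : (`|j| <= N)%N -> c' s j = r * c s j by rewrite /c' => ->.
pose v s j := (c' s j)%:C : R[i].
have v0 s j : (N < `|j|)%N -> v s j = 0 by move=> Nj; rewrite /v c'0.
have nv s : sqnorm_ell2 (v s) = (r ^+ 2 * zpsum (fun t => c s t ^+ 2) N)%:E.
  rewrite (@sqnorm_supp _ N)//; last exact: v0.
  rewrite -zpsumMl; congr EFin; apply: eq_zpsum => j jN.
  by rewrite /sqnormc /v /= expr0n addr0 c'E// exprMn.
have : (e%:E <= (complex.Re (dot_ell2p v
    (block_mul (fun a b => cplx_imx (A a b)) v)))%:E)%E.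
  apply: le_trans eA _; apply: ereal_inf_lbound; exists v => //; split.
    by move=> s; rewrite /ell2 /= nv ltry.
  rewrite /sqnorm_ell2p; under eq_bigr do rewrite nv.
  by rewrite sumEFin -big_distrr /= -/S rr mulVf.
rewrite lee_fin (@quadratic_value N)// => eQ.
rewrite -ler_pdivlMr//; apply: le_trans eQ _; rewrite mulrC -rr big_distrr/=.
rewrite le_eqVlt; apply/orP; left; apply/eqP; apply: eq_bigr => s _.
rewrite -zpsumMl; apply: eq_zpsum => t tN; rewrite c'E// expr2 -!mulrA.
congr (_ * _); rewrite [RHS]mulrCA; congr (_ * _).
rewrite big_distrr/=; apply: eq_bigr => b _; rewrite -zpsumMl.
by apply: eq_zpsum => tau tauN; rewrite c'E// mulrCA.
Qed.

End Quadratic.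
End Ell2.

(** * The inverse covariance operator is bounded *)

(** [K] bounds the square of the operator norm on finitely supported real
    sequences. *)
Definition bounded_imx (R : realType) (K : R) (A : int -> int -> R) : Prop :=
  forall m n (c : int -> R),
    zpsum (fun t => zpsum (fun tau => A t tau * c tau) n ^+ 2) m <=
    K * zpsum (fun tau => c tau ^+ 2) n.

Section Covariance.
Context {d : measure_display} {Omega : measurableType d} {R : realType}.
Variable P : probability Omega R.

(** Square-integrable random variables as a vector space, on which the
    covariance is a semidefinite bilinear form. *)
Definition L2rv := LfunType P (lee1n 2).

Definition cov (U V : L2rv) : R := fine (covariance P U V).

Lemma L2rv_in (U : L2rv) : (U : Omega -> R) \in Lfun P 2%:E.
Proof. exact: LfunP. Qed.

Lemma covariance_L2_fin (f g : Omega -> R) :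
  f \in Lfun P 2%:E -> g \in Lfun P 2%:E -> covariance P f g \is a fin_num.
Proof.
move=> f2 g2; have Pfin : P setT \is a fin_num := fin_num_measure P _ measurableT.
apply: covariance_fin_num; [exact: Lfun_subset12|exact: Lfun_subset12|].
exact: Lfun2_mul_Lfun1.
Qed.

Lemma covDl (u v w : L2rv) : cov (u + v) w = cov u w + cov v w.
Proof.
by rewrite /cov -fineD ?covariance_L2_fin ?L2rv_in// -covarianceDl ?L2rv_in.
Qed.

Lemma covZl a (u w : L2rv) : cov (a *: u) w = a * cov u w.
Proof.
have Pfin : P setT \is a fin_num := fin_num_measure P _ measurableT.
have -> : a * cov u w = fine (a%:E * covariance P u w).
  by rewrite fineM ?covariance_L2_fin ?L2rv_in.
rewrite /cov -covarianceZl; last 3 first.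
- exact: Lfun_subset12 (L2rv_in u).
- exact: Lfun_subset12 (L2rv_in w).
- exact: Lfun2_mul_Lfun1 (L2rv_in u) (L2rv_in w).
by congr (fine (covariance P _ _)); apply/funext => x; rewrite /= mulrC.
Qed.

Lemma covC (u v : L2rv) : cov u v = cov v u.
Proof. by rewrite /cov covarianceC. Qed.

Lemma cov_ge0 (u : L2rv) : 0 <= cov u u.
Proof. by apply: fine_ge0; exact: variance_ge0. Qed.

Lemma L2rv_sumE (J : Type) (s : seq J) (F : J -> L2rv) w :
  (\sum_(i <- s) F i : L2rv) w = \sum_(i <- s) F i w.
Proof.
elim: s => [|i s IH]; first by rewrite !big_nil.
by rewrite !big_cons -IH.
Qed.

Lemma cov_norm_cvg0 (f : nat -> Omega -> R) (U : nat -> L2rv) :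
  (forall n, f n =1 U n) ->
  (fun n => 'V_P[f n]%E) @ \oo --> 0%E ->
  (fun n => cov (U n) (U n)) @ \oo --> 0.
Proof.
move=> fU /fine_cvg; apply: cvg_trans; apply: near_eq_cvg; apply: nearW => n.
by rewrite /= /cov; have /funext -> := fU n.
Qed.

End Covariance.

Section InverseCovariance.
Context {d : measure_display} {Omega : measurableType d} {R : realType}.
Variables (P : probability Omega R) (p : nat).
Variables (X : int -> 'I_p -> Omega -> R).
Hypothesis hX : forall t a, centredL2 P (X t a).
Variables (PX : int -> 'I_p -> Omega -> R).
Variables (beta : int -> 'I_p -> int -> 'I_p -> R).
Hypothesis hbeta : projection_coefficients P X PX beta.
Variable lam : R.
Hypothesis lam_gt0 : 0 < lam.
Hypothesis lam_inf : (lam%:E <= lambda_inf (cov_block P X))%E.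

Let I := (int * 'I_p)%type.
Let W n : seq I := [seq (t, a) | t <- window n, a <- enum 'I_p].

Let sumW (V : zmodType) (F : I -> V) n :
  \sum_(i <- W n) F i = zpsum (fun t => \sum_(a < p) F (t, a)) n.
Proof.
rewrite big_allpairs zpsum_window; apply: eq_bigr => t _.
by rewrite big_enum.
Qed.

Let W_uniq n : uniq (W n).
Proof.
by apply: allpairs_uniq; rewrite ?window_uniq ?enum_uniq//= => -[? ?] [? ?] _ _ [-> ->].
Qed.

Let mem_W i n : (i \in W n) = (`|i.1| <= n)%N.
Proof.
case: i => t a; apply/allpairsP/idP => [[[t' a'] /= [tn _ [-> _]]]|tn].
  by rewrite -mem_window.
by exists (t, a); rewrite mem_enum mem_window.
Qed.

Let Xv (i : I) : L2rv P := Lfun_Sub (lee1n 2) (hX i.1 i.2).1.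

Let PXin (i : I) : centredL2 P (PX i.1 i.2).
Proof. by have [[[]]] := hbeta i.1 i.2. Qed.

Let PXv (i : I) : L2rv P := Lfun_Sub (lee1n 2) (PXin i).1.

(** Coordinates of the residual of [X i] in the system [X]. *)
Let coef (i l : I) : R := (l == i)%:R - beta l.1 l.2 i.1 i.2.

Let res i : L2rv P := Xv i - PXv i.
Let sigma2 i := residual_variance P X PX i.2 i.1.

Let W_exhaust i : \forall n \near \oo, i \in W n.
Proof. by exists `|i.1|%N => // n /=; rewrite mem_W. Qed.

Let coercive n (c : I -> R) :
  lam * \sum_(i <- W n) c i ^+ 2 <=
    cov (\sum_(i <- W n) c i *: Xv i) (\sum_(i <- W n) c i *: Xv i).
Proof.
have := @lambda_inf_coercive R p (cov_block P X) lam n (fun s t => c (t, s)) lam_inf.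
have swap (F : I -> R) : \sum_(s < p) zpsum (fun t => F (t, s)) n = \sum_(i <- W n) F i.
  under eq_bigr do rewrite zpsum_window.
  by rewrite exchange_big sumW zpsum_window.
have /= -> := swap (fun i => c i ^+ 2); congr (_ <= _).
rewrite (form_suml (@covDl _ _ _ P) (@covZl _ _ _ P)) -swap.
apply: eq_bigr => s _; apply: eq_zpsum => t _; rewrite covZl; congr (_ * _).
rewrite (form_sumr (@covDl _ _ _ P) (@covZl _ _ _ P) (@covC _ _ _ P)) -swap.
apply: eq_bigr => b _; apply: eq_zpsum => tau _.
by rewrite covC covZl covC mulrC /cov_block mxE.
Qed.

Let span_X (i j : I) : j != i -> span_without P X i.1 i.2 (X j.1 j.2).
Proof.
move=> ji; split=> // e e0; exists [:: (1, j)]; split.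
  by move=> q; rewrite inE => /eqP -> /=; rewrite -surjective_pairing.
rewrite (_ : (fun w => _) = cst 0) ?variance_cst ?lte_fin//.
by apply/funext => w; rewrite big_seq1 mul1r subrr.
Qed.

Let res_orth i (V : L2rv P) : span_without P X i.1 i.2 V -> cov (res i) V = 0.
Proof.
move=> VS; have [[_ h] _ _] := hbeta i.1 i.2.
by rewrite /cov -[RHS]/(fine 0%E) -(h _ VS).
Qed.

Let res_Xv i j : j != i -> cov (res i) (Xv j) = 0.
Proof. by move=> ji; apply: res_orth; exact: span_X. Qed.

Let res_PXv i : cov (res i) (PXv i) = 0.
Proof. by apply: res_orth; have [[]] := hbeta i.1 i.2. Qed.

Let res_res i : cov (res i) (res i) = cov (res i) (Xv i).
Proof.
by rewrite {2}/res (formBr (@covDl _ _ _ P) (@covZl _ _ _ P) (@covC _ _ _ P))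
  res_PXv subr0.
Qed.

Let sigma2E i : sigma2 i = cov (res i) (res i).
Proof.
have Pfin : P setT \is a fin_num := fin_num_measure P _ measurableT.
have r2 := L2rv_in (res i); have r1 := Lfun_subset12 Pfin r2.
have rr := Lfun2_mul_Lfun1 r2 r2.
rewrite /cov covarianceE//.
have -> : 'E_P[res i]%E = 0%E.
  have x1 := Lfun_subset12 Pfin (L2rv_in (Xv i)).
  have p1 := Lfun_subset12 Pfin (L2rv_in (PXv i)).
  transitivity ('E_P[Xv i] - 'E_P[PXv i])%E; first by rewrite -expectationB.
  by rewrite (hX i.1 i.2).2 (PXin i).2 sube0.
by rewrite mule0 sube0.
Qed.

Let res_expansion i :
  (fun n => cov (res i - \sum_(l <- W n) coef i l *: Xv l)
                (res i - \sum_(l <- W n) coef i l *: Xv l)) @ \oo --> 0.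
Proof.
pose S n : L2rv P := \sum_(l <- W n) beta l.1 l.2 i.1 i.2 *: Xv l.
have : (fun n => cov (PXv i - S n) (PXv i - S n)) @ \oo --> 0.
  have [_ _] := hbeta i.1 i.2; apply: cov_norm_cvg0 => n w.
  rewrite -[RHS]/(PX i.1 i.2 w - S n w); congr (_ - _).
  rewrite /S L2rv_sumE sumW; apply: eq_zpsum => t _.
  by apply: eq_bigr => b _.
move/(form_cvg0_Z (@covZl _ _ _ P) (@covC _ _ _ P) (-1)).
apply: cvg_trans; apply: near_eq_cvg; have := W_exhaust i.
apply: filterS => n iW; suff -> : res i - \sum_(l <- W n) coef i l *: Xv l =
  -1 *: (PXv i - S n) by [].
under eq_bigr do rewrite scalerBl.
rewrite sumrB (bigD1_seq i)//= eqxx scale1r big1 => [|j /negbTE ->]; last first.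
  by rewrite scale0r.
by rewrite addr0 scaleN1r opprB -/(S n) /res opprB addrC addrA subrK.
Qed.

(** A residual has the coordinate 1 on its own variable, so coercivity bounds its
    variance from below by [lam]. *)
Let sigma2_gt0 i : 0 < sigma2 i.
Proof.
apply: lt_le_trans lam_gt0 _; rewrite sigma2E.
have h := form_cvg_norm (@covDl _ _ _ P) (@covZl _ _ _ P) (@covC _ _ _ P)
  (@cov_ge0 _ _ _ P) (res_expansion i).
rewrite -(cvg_lim _ h)//; apply: limr_ge.
  by apply/cvg_ex; exists (cov (res i) (res i)).
have := W_exhaust i; apply: filterS => n iW; apply: le_trans (coercive n _).
rewrite -[leLHS]mulr1 ler_pM2l// (bigD1_seq i)//= /coef eqxx.
have [_ -> _] := hbeta i.1 i.2; rewrite subr0 expr1n lerDl.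
by apply: sumr_ge0 => j _; exact: sqr_ge0.
Qed.

(** Normalised residuals: [res i] is orthogonal to every [X j] with [j != i], and
    its product with [X i] is [sigma2 i]. *)
Let Z i : L2rv P := (sigma2 i)^-1 *: res i.
Let D (k l : I) := Dblock P X PX beta k.2 l.2 k.1 l.1.

(** The zero diagonal of [beta] makes both branches of [Dblock] the same
    formula. *)
Let D_coef k l : D k l = (sigma2 k)^-1 * coef k l.
Proof.
rewrite /D /Dblock /coef -/(sigma2 k); case: k l => [t a] [s b] /=.
have -> : ((a, t) == (b, s)) = ((s, b) == (t, a)).
  by rewrite !xpair_eqE andbC eq_sym [b == a]eq_sym.
case: eqP => [[-> ->]|_]; last by rewrite sub0r mulrC.
by have [_ -> _] := hbeta t a; rewrite subr0 mulr1.
Qed.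

Let Z_expansion k :
  (fun n => cov (Z k - \sum_(l <- W n) D k l *: Xv l)
                (Z k - \sum_(l <- W n) D k l *: Xv l)) @ \oo --> 0.
Proof.
have := form_cvg0_Z (@covZl _ _ _ P) (@covC _ _ _ P)
  (sigma2 k)^-1 (res_expansion k).
apply: cvg_trans; apply: near_eq_cvg; apply: nearW => n.
suff -> : Z k - \sum_(l <- W n) D k l *: Xv l =
  (sigma2 k)^-1 *: (res k - \sum_(l <- W n) coef k l *: Xv l) by [].
rewrite scalerBr scaler_sumr; congr (_ - _); apply: eq_bigr => l _.
by rewrite D_coef scalerA.
Qed.

Let biorthogonal k l : cov (Xv k) (Z l) = (k == l)%:R.
Proof.
rewrite covC covZl; have [->|kl] := eqVneq k l; last by rewrite res_Xv ?mulr0.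
by rewrite -res_res -sigma2E mulVf// gt_eqF.
Qed.

(** The matrix [D] indexed by pairs (time, component) is the Gram matrix of the
    normalised residuals, to which [gram_bound] applies; a block is a compression
    of it. *)
Lemma Dblock_bounded a b : bounded_imx (lam ^- 2) (Dblock P X PX beta a b).
Proof.
move=> m n c; pose c' (i : I) := if i.2 == b then c i.1 else 0.
have := gram_bound (@covDl _ _ _ P) (@covZl _ _ _ P) (@covC _ _ _ P)
  (@cov_ge0 _ _ _ P) W_uniq W_exhaust lam_gt0 coercive biorthogonal Z_expansion m n c'.
have restr (F : I -> R) :
    \sum_(k <- W n) F k * c' k = zpsum (fun tau => F (tau, b) * c tau) n.
  rewrite sumW; apply: eq_zpsum => tau _; rewrite (bigD1 b)//= /c' eqxx.
  by rewrite big1 ?addr0// => i /negbTE /= ->; rewrite mulr0.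
have -> : \sum_(k <- W n) c' k ^+ 2 = zpsum (fun tau => c tau ^+ 2) n.
  under eq_bigr do rewrite expr2.
  by rewrite restr; apply: eq_zpsum => tau _; rewrite /c' eqxx expr2.
apply: le_trans; rewrite sumW; apply: le_zpsum => t.
by rewrite (bigD1 a)//= restr lerDl sumr_ge0// => i _; exact: sqr_ge0.
Qed.

End InverseCovariance.

(** * Complex integrals and exponentials on the circle *)

Section ComplexIntegral.
Local Open Scope complex_scope.
Context {R : realType}.
Local Notation mu := (@lebesgue_measure R).
Local Notation D := (@circle R).
Implicit Types (f g h m : R -> R[i]) (z : R[i]).

Lemma measurable_circle : measurable D.
Proof. exact: measurable_itv. Qed.
Local Hint Resolve measurable_circle : core.

Lemma twopi_gt0 : 0 < 2 * pi :> R.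
Proof. by rewrite mulr_gt0// pi_gt0. Qed.

Lemma mu_circle : mu D = (2 * pi)%:E.
Proof. by rewrite /circle lebesgue_measure_itv/= lte_fin twopi_gt0 sube0. Qed.

Lemma ReD z w : complex.Re (z + w) = complex.Re z + complex.Re w.
Proof. by case: z w => ? ? []. Qed.
Lemma ImD z w : complex.Im (z + w) = complex.Im z + complex.Im w.
Proof. by case: z w => ? ? []. Qed.
Lemma ReN z : complex.Re (- z) = - complex.Re z.
Proof. by case: z. Qed.
Lemma ImN z : complex.Im (- z) = - complex.Im z.
Proof. by case: z. Qed.
Lemma ReM z w : complex.Re (z * w) =
  complex.Re z * complex.Re w - complex.Im z * complex.Im w.
Proof. by case: z w => ? ? []. Qed.
Lemma ImM z w : complex.Im (z * w) =
  complex.Re z * complex.Im w + complex.Im z * complex.Re w.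
Proof. by case: z w => ? ? []. Qed.
Lemma complex_ext z w :
  complex.Re z = complex.Re w -> complex.Im z = complex.Im w -> z = w.
Proof. by case: z w => ? ? [? ?] /= -> ->. Qed.

Lemma Re_realM (a : R) z : complex.Re (a%:C * z) = a * complex.Re z.
Proof. by rewrite ReM /= mul0r subr0. Qed.
Lemma Im_realM (a : R) z : complex.Im (a%:C * z) = a * complex.Im z.
Proof. by rewrite ImM /= mul0r addr0. Qed.

Lemma Re_zpsum (F : int -> R[i]) n :
  complex.Re (zpsum F n) = zpsum (fun j => complex.Re (F j)) n.
Proof. by rewrite !zpsum_window (big_morph _ ReD (erefl : complex.Re 0 = 0)). Qed.

Lemma Im_zpsum (F : int -> R[i]) n :
  complex.Im (zpsum F n) = zpsum (fun j => complex.Im (F j)) n.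
Proof. by rewrite !zpsum_window (big_morph _ ImD (erefl : complex.Im 0 = 0)). Qed.

Definition integrableC g : Prop :=
  mu.-integrable D (fun x => (complex.Re (g x))%:E) /\
  mu.-integrable D (fun x => (complex.Im (g x))%:E).

Lemma eq_integrableC f g : (forall x, f x = g x) -> integrableC f -> integrableC g.
Proof. by move=> /funext ->. Qed.

Lemma integrableCD f g :
  integrableC f -> integrableC g -> integrableC (fun x => f x + g x).
Proof.
move=> [rf jf] [rg jg]; split.
- by under eq_fun do rewrite ReD EFinD; exact: integrableD.
- by under eq_fun do rewrite ImD EFinD; exact: integrableD.
Qed.

Lemma integrableCZ z f : integrableC f -> integrableC (fun x => z * f x).
Proof.
move=> [rf jf]; split.
- under eq_fun do rewrite ReM EFinB !EFinM.
  by apply: integrableB => //; exact: integrableZl.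
- under eq_fun do rewrite ImM EFinD !EFinM.
  by apply: integrableD => //; exact: integrableZl.
Qed.

Lemma integrableCB f g :
  integrableC f -> integrableC g -> integrableC (fun x => f x - g x).
Proof.
move=> fi gi; apply: (eq_integrableC _ (integrableCD fi (integrableCZ (-1) gi))).
by move=> x; rewrite mulN1r.
Qed.

Lemma integralCD f g : integrableC f -> integrableC g ->
  integralC (fun x => f x + g x) = integralC f + integralC g.
Proof.
move=> [rf jf] [rg jg]; apply: complex_ext; rewrite ?ReD ?ImD /=.
- by under eq_Rintegral do rewrite ReD; rewrite RintegralD.
- by under eq_Rintegral do rewrite ImD; rewrite RintegralD.
Qed.

Lemma integrableRZl (k : R) (h : R -> R) : mu.-integrable D (EFin \o h) ->
  mu.-integrable D (EFin \o (fun x => k * h x)).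
Proof. by move=> hi; exact: (integrableZl _ k hi). Qed.

Lemma integrableRD (h k : R -> R) : mu.-integrable D (EFin \o h) ->
  mu.-integrable D (EFin \o k) -> mu.-integrable D (EFin \o (fun x => h x + k x)).
Proof. by move=> hi ki; exact: (integrableD _ hi ki). Qed.

Lemma integrableRB (h k : R -> R) : mu.-integrable D (EFin \o h) ->
  mu.-integrable D (EFin \o k) -> mu.-integrable D (EFin \o (fun x => h x - k x)).
Proof. by move=> hi ki; exact: (integrableB _ hi ki). Qed.

Lemma integralCZ z f : integrableC f ->
  integralC (fun x => z * f x) = z * integralC f.
Proof.
move=> [rf jf]; apply: complex_ext; rewrite ?ReM ?ImM /=.
- under eq_Rintegral do rewrite ReM.
  rewrite RintegralB ?RintegralZl//.
  + exact: integrableRZl.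
  + exact: integrableRZl.
- under eq_Rintegral do rewrite ImM.
  rewrite RintegralD ?RintegralZl//.
  + exact: integrableRZl.
  + exact: integrableRZl.
Qed.

Lemma integralCB f g : integrableC f -> integrableC g ->
  integralC (fun x => f x - g x) = integralC f - integralC g.
Proof.
move=> fi gi; rewrite -[X in _ + X]mulN1r -integralCZ// -integralCD//; last first.
  exact: integrableCZ.
by congr integralC; apply/funext => x; rewrite mulN1r.
Qed.

Lemma integrableC0 : integrableC (fun=> 0).
Proof. by split; exact: integrable0. Qed.

Lemma integralC0 : integralC (fun=> 0 : R[i]) = 0.
Proof. by apply: complex_ext => /=; rewrite Rintegral_cst// mul0r. Qed.

Lemma integralC_zpsum (F : int -> R -> R[i]) n :
  (forall j, integrableC (F j)) ->
  integralC (fun x => zpsum (F ^~ x) n) = zpsum (fun j => integralC (F j)) n.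
Proof.
move=> Fi; under eq_fun do rewrite zpsum_window.
rewrite zpsum_window.
suff [] : integrableC (fun x => \sum_(j <- window n) F j x) /\
  integralC (fun x => \sum_(j <- window n) F j x) =
  \sum_(j <- window n) integralC (F j) by [].
elim: (window n) => [|j s [IHi IH]].
  under eq_fun do rewrite big_nil; rewrite big_nil.
  by split; [exact: integrableC0|exact: integralC0].
under eq_fun do rewrite big_cons; rewrite big_cons; split.
  exact: integrableCD.
by rewrite integralCD// IH.
Qed.

Lemma integralC_ae f g :
  integrableC f -> integrableC g -> ae_eq mu D f g -> integralC f = integralC g.
Proof.
move=> [rf jf] [rg jg] fg; apply: complex_ext => /=; congr fine;
  apply: ae_eq_integral.
- exact: measurable_circle.
- exact: measurable_int rf.
- exact: measurable_int rg.
- by apply: filterS fg => x /[apply] /= ->.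
- exact: measurable_circle.
- exact: measurable_int jf.
- exact: measurable_int jg.
- by apply: filterS fg => x /[apply] /= ->.
Qed.

Lemma cisD (x y : R) : cis (x + y) = cis x * cis y.
Proof.
by apply: complex_ext; rewrite ?ReM ?ImM /= ?cosD ?sinD//; ring.
Qed.

Lemma cis0 : cis (0 : R) = 1.
Proof. by rewrite /cis cos0 sin0. Qed.

Lemma conj_cis (x : R) : (conjc (cis x)) = cis (- x).
Proof. by rewrite /cis cosN sinN. Qed.

Lemma conjM_cis z (x : R) : conjc (z * cis (- x)) = conjc z * cis x.
Proof.
by case: z => a b; apply: complex_ext => /=; rewrite cosN sinN; ring.
Qed.

Lemma sqnormc_cis (x : R) : sqnormc (cis x) = 1.
Proof. exact: cos2Dsin2. Qed.

Lemma measurable_cosM (a : R) : measurable_fun D (fun x => cos (a * x)).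
Proof.
apply: measurable_funTS; apply: (measurableT_comp (f := @cos R)).
  by apply: continuous_measurable_fun; exact: continuous_cos.
exact: measurable_funM.
Qed.

Lemma measurable_sinM (a : R) : measurable_fun D (fun x => sin (a * x)).
Proof.
apply: measurable_funTS; apply: (measurableT_comp (f := @sin R)).
  by apply: continuous_measurable_fun; exact: continuous_sin.
exact: measurable_funM.
Qed.

Lemma bounded_le1 (h : R -> R) : (forall x, `|h x| <= 1) ->
  [bounded h x | x in D].
Proof.
move=> h1; exists 1; split; first exact: num_real.
by move=> M M1 x _ /=; apply: le_trans (h1 x) (ltW M1).
Qed.

Lemma integrableM_cos (a : R) (h : R -> R) : mu.-integrable D (EFin \o h) ->
  mu.-integrable D (fun x => (h x * cos (a * x))%:E).
Proof.
move=> hi; under eq_fun do rewrite EFinM.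
apply: integrableMl => //; first exact: measurable_cosM.
by apply: bounded_le1 => x; exact: cos_max.
Qed.

Lemma integrableM_sin (a : R) (h : R -> R) : mu.-integrable D (EFin \o h) ->
  mu.-integrable D (fun x => (h x * sin (a * x))%:E).
Proof.
move=> hi; under eq_fun do rewrite EFinM.
apply: integrableMl => //; first exact: measurable_sinM.
by apply: bounded_le1 => x; exact: sin_max.
Qed.

Lemma integrableCM_cis f (a : R) :
  integrableC f -> integrableC (fun x => f x * cis (a * x)).
Proof.
move=> [rf jf]; split.
- under eq_fun do rewrite ReM EFinB.
  by apply: integrableB => //; [exact: integrableM_cos|exact: integrableM_sin].
- under eq_fun do rewrite ImM EFinD.
  by apply: integrableD => //; [exact: integrableM_sin|exact: integrableM_cos].
Qed.

Lemma cis_2pi (j : int) : cis (j%:~R * (2 * pi)) = 1 :> R[i].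
Proof.
have nat_case (n : nat) : cis (n%:R * (2 * pi)) = 1 :> R[i].
  have -> : n%:R * (2 * pi) = 0 + (pi *+ 2) *+ n :> R.
    by rewrite add0r -[RHS]mulr_natl -[pi *+ 2]mulr_natl.
  rewrite /cis (periodicn (@cosD2pi R)) (periodicn (@sinD2pi R)).
  by rewrite cos0 sin0.
case: j => n; first exact: nat_case.
rewrite NegzE mulrNz mulNr -conj_cis.
by rewrite [X in (conjc (cis X))](_ : _ = n.+1%:R * (2 * pi)) ?nat_case ?conjc1.
Qed.

Lemma integrableC_cst z : integrableC (fun=> z).
Proof.
suff icst (r : R) : mu.-integrable D (EFin \o (fun=> r)).
  by split; exact: icst.
have muD : (mu D < +oo)%E by rewrite mu_circle ltry.
apply: (@measurable_bounded_integrable _ _ R mu) => //.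
exists `|r|; split; first exact: num_real.
by move=> M M1 x _ /=; exact: ltW.
Qed.

Lemma Rintegral_circle_cst (r : R) : \int[mu]_(x in D) r = 2 * pi * r.
Proof.
transitivity (r * fine (mu D)); last by rewrite mu_circle /= mulrC.
exact: Rintegral_cst.
Qed.

Lemma integralC_cst z : integralC (fun=> z) = (2 * pi)%:C * z.
Proof.
by apply: complex_ext; rewrite ?ReM ?ImM /= Rintegral_circle_cst; ring.
Qed.

Lemma integral_deriv_circle (F f : R -> R) :
  (forall x, is_derive x (1 : R) F (f x)) -> continuous f ->
  \int[mu]_(x in D) f x = F (2 * pi) - F 0.
Proof.
move=> dF cf.
have cF : continuous F.
  by move=> x; apply: differentiable_continuous; apply/derivable1_diffP; have [] := dF x.
have fw : {within `[0, 2 * pi], continuous f} by exact: continuous_subspaceT.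
rewrite /circle Rintegral_itv_bndo_bndc; last first.
  have : mu.-integrable `[0, 2 * pi]%classic (EFin \o f).
    by apply: continuous_compact_integrable => //; exact: segment_compact.
  by apply: integrableS => //; exact: subset_itv_co_cc.
rewrite /Rintegral (@continuous_FTC2 _ f F) ?twopi_gt0//.
- split.
  + by move=> x _; have [] := dF x.
  + exact/cvg_at_right_filter/cF.
  + exact/cvg_at_left_filter/cF.
- by move=> x _; rewrite derive1E; have [] := dF x.
Qed.

Lemma integralC_cis (j : int) : j != 0 ->
  integralC (fun x => cis (j%:~R * x)) = 0 :> R[i].
Proof.
move=> j0; have jR : j%:~R != 0 :> R by rewrite intr_eq0.
have := cis_2pi j; rewrite /cis => -[c2 s2].
have dj x : is_derive x (1 : R) ( *%R (j%:~R : R)) (j%:~R).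
  by apply: is_derive_eq; rewrite /GRing.scale /= mulr1.
have ds x : is_derive x (1 : R) (fun x => j%:~R^-1 * sin (j%:~R * x)) (cos (j%:~R * x)).
  have := is_derive1_comp (is_derive_sin (j%:~R * x)) (dj x) => ?.
  by apply: is_derive_eq; rewrite /GRing.scale/=; field.
have dc x : is_derive x (1 : R) (fun x => - j%:~R^-1 * cos (j%:~R * x)) (sin (j%:~R * x)).
  have := is_derive1_comp (is_derive_cos (j%:~R * x)) (dj x) => ?.
  by apply: is_derive_eq; rewrite /GRing.scale/=; field.
apply: complex_ext => /=.
- rewrite (integral_deriv_circle ds).
  + by rewrite s2 !mulr0 sin0 mulr0 subrr.
  + move=> x; apply: continuous_comp; first exact: mulrl_continuous.
    exact: continuous_cos.
- rewrite (integral_deriv_circle dc).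
  + by rewrite c2 mulr0 cos0 subrr.
  + move=> x; apply: continuous_comp; first exact: mulrl_continuous.
    exact: continuous_sin.
Qed.

End ComplexIntegral.

(** * Square-integrable functions and Fourier coefficients *)

Section L2Space.
Local Open Scope complex_scope.
Context {R : realType}.
Local Notation mu := (@lebesgue_measure R).
Local Notation D := (@circle R).
Implicit Types (f g h m : R -> R[i]) (z : R[i]) (v w : int -> R[i]).

Local Hint Extern 0 (measurable _) => exact: measurable_circle : core.

Definition measurableC g : Prop :=
  measurable_fun D (fun x => complex.Re (g x)) /\
  measurable_fun D (fun x => complex.Im (g x)).

Lemma L2_measurable g : L2 g -> measurableC g.
Proof. by case. Qed.

Lemma measurableC_D f g :
  measurableC f -> measurableC g -> measurableC (fun x => f x + g x).
Proof.
move=> [rf jf] [rg jg]; split.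
- by under eq_fun do rewrite ReD; exact: measurable_funD.
- by under eq_fun do rewrite ImD; exact: measurable_funD.
Qed.

Lemma measurableC_M f g :
  measurableC f -> measurableC g -> measurableC (fun x => f x * g x).
Proof.
move=> [rf jf] [rg jg]; split.
- under eq_fun do rewrite ReM.
  by apply: measurable_funB; exact: measurable_funM.
- under eq_fun do rewrite ImM.
  by apply: measurable_funD; exact: measurable_funM.
Qed.

Lemma measurableC_conj f : measurableC f -> measurableC (fun x => (conjc (f x))).
Proof.
move=> [rf jf]; split.
- by rewrite (_ : (fun _ => _) = (fun x => complex.Re (f x)))//;
    apply/funext => x; case: (f x).
- rewrite (_ : (fun _ => _) = (fun x => - complex.Im (f x))).
    exact: measurable_funN.
  by apply/funext => x; case: (f x).
Qed.

Lemma measurable_sqnormc f : measurableC f ->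
  measurable_fun D (fun x => sqnormc (f x)).
Proof.
by move=> [rf jf]; apply: measurable_funD; exact: measurable_funX.
Qed.

Lemma sqnorm_L2_sqnormc g :
  sqnorm_L2 g = (\int[mu]_(x in D) (sqnormc (g x))%:E)%E.
Proof. by apply: eq_integral => x _; rewrite normc_sqr. Qed.

Definition L2sqnorm g : R := \int[mu]_(x in D) sqnormc (g x).

Lemma L2P g : L2 g <->
  measurableC g /\ mu.-integrable D (fun x => (sqnormc (g x))%:E).
Proof.
have absE : (\int[mu]_(x in D) `|(sqnormc (g x))%:E| = sqnorm_L2 g)%E.
  rewrite sqnorm_L2_sqnormc; apply: eq_integral => x _.
  by rewrite gee0_abs// lee_fin sqnormc_ge0.
split=> [[rg jg gy]|[[rg jg] /integrableP[_ gy]]]; split => //.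
- have mg := @measurable_sqnormc g (conj rg jg).
  by apply/integrableP; split; [exact/measurable_EFinP|rewrite absE].
- by rewrite -absE.
Qed.

Lemma sqnorm_L2E g : L2 g -> sqnorm_L2 g = (L2sqnorm g)%:E.
Proof.
move=> /L2P[_ gi]; rewrite sqnorm_L2_sqnormc /L2sqnorm /Rintegral fineK//.
exact: (@integrable_fin_num _ _ R mu _ measurable_circle _ gi).
Qed.

Lemma L2sqnorm_ge0 g : 0 <= L2sqnorm g.
Proof. by apply: Rintegral_ge0 => x _; exact: sqnormc_ge0. Qed.

Lemma L2_le g (G : R -> R) : measurableC g ->
  mu.-integrable D (EFin \o G) -> (forall x, sqnormc (g x) <= G x) -> L2 g.
Proof.
move=> mg Gi gG; apply/L2P; split => //.
apply: (@le_integrable _ _ R mu D measurable_circle _ _ _ _ Gi).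
  by apply/measurable_EFinP; exact: measurable_sqnormc.
by move=> x _ /=; rewrite lee_fin !ger0_norm ?(le_trans _ (gG x)) ?sqnormc_ge0.
Qed.

Lemma sqnormcM z1 z2 : sqnormc (z1 * z2) = sqnormc z1 * sqnormc z2.
Proof. by rewrite /sqnormc ReM ImM; ring. Qed.

Lemma sqnormcD_le z1 z2 : sqnormc (z1 + z2) <= 2 * sqnormc z1 + 2 * sqnormc z2.
Proof.
rewrite /sqnormc ReD ImD.
have := sqr_ge0 (complex.Re z1 - complex.Re z2).
have := sqr_ge0 (complex.Im z1 - complex.Im z2).
rewrite !sqrrD !sqrrN; lra.
Qed.

Lemma L2D f g : L2 f -> L2 g -> L2 (fun x => f x + g x).
Proof.
move=> /L2P[mf fi] /L2P[mg gi].
apply: (@L2_le _ (fun x => 2 * sqnormc (f x) + 2 * sqnormc (g x))).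
- exact: measurableC_D.
- by apply: integrableRD; exact: integrableRZl.
- by move=> x; exact: sqnormcD_le.
Qed.

Lemma L2Z z f : L2 f -> L2 (fun x => z * f x).
Proof.
move=> /L2P[mf fi]; apply: (@L2_le _ (fun x => sqnormc z * sqnormc (f x))).
- by apply: measurableC_M => //; split; exact: measurable_cst.
- exact: integrableRZl.
- by move=> x; rewrite sqnormcM.
Qed.

Lemma L2B f g : L2 f -> L2 g -> L2 (fun x => f x - g x).
Proof.
move=> fi /(L2Z (-1))/(L2D fi).
by under eq_fun do rewrite mulN1r.
Qed.

Lemma L2M_cis f (a : R) : L2 f -> L2 (fun x => f x * cis (a * x)).
Proof.
move=> /L2P[mf fi]; apply: (L2_le _ fi).
- apply: measurableC_M => //; split; first exact: measurable_cosM.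
  exact: measurable_sinM.
- by move=> x; rewrite sqnormcM sqnormc_cis mulr1.
Qed.

Lemma L2_cst z : L2 (fun=> z).
Proof.
apply: (@L2_le _ (fun=> sqnormc z)) => //.
by case: (@integrableC_cst R (sqnormc z)%:C).
Qed.

Lemma L2_zpsum (F : int -> R -> R[i]) n :
  (forall j, L2 (F j)) -> L2 (fun x => zpsum (F ^~ x) n).
Proof.
move=> Fi; under eq_fun do rewrite zpsum_window.
elim: (window n) => [|j s IH].
  by under eq_fun do rewrite big_nil; exact: L2_cst.
by under eq_fun do rewrite big_cons; exact: L2D.
Qed.

Lemma L2_conj f : L2 f -> L2 (fun x => (conjc (f x))).
Proof.
move=> /L2P[mf fi]; apply: (L2_le (measurableC_conj mf) fi) => x.
by rewrite /sqnormc; case: (f x) => a b /=; rewrite sqrrN.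
Qed.

(** Young's inequality with a free parameter. It replaces the Cauchy-Schwarz
    inequality in [pairing_cvg]: the parameter is chosen last. *)
Lemma Re_mul_le (e : R) z1 z2 : 0 < e ->
  `|complex.Re (z1 * z2)| <= (e * sqnormc z1 + e^-1 * sqnormc z2) / 2.
Proof.
move=> e0; have e1 : e * e^-1 = 1 by rewrite mulfV ?gt_eqF.
have ei : 0 < e^-1 by rewrite invr_gt0.
case: z1 z2 => a b [a' b']; rewrite ReM /sqnormc /=.
have p1 := mulr_ge0 (ltW ei) (sqr_ge0 (e * a - a')).
have p2 := mulr_ge0 (ltW ei) (sqr_ge0 (e * a + a')).
have p3 := mulr_ge0 (ltW ei) (sqr_ge0 (e * b - b')).
have p4 := mulr_ge0 (ltW ei) (sqr_ge0 (e * b + b')).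
have E (x y : R) : e^-1 * (e * x + y) ^+ 2 = e * x ^+ 2 + 2 * x * y + e^-1 * y ^+ 2.
  by field; rewrite gt_eqF.
have E' (x y : R) : e^-1 * (e * x - y) ^+ 2 = e * x ^+ 2 - 2 * x * y + e^-1 * y ^+ 2.
  by field; rewrite gt_eqF.
rewrite !(E, E') in p1 p2 p3 p4.
rewrite ler_norml; apply/andP; split; lra.
Qed.

Lemma Im_mul_le (e : R) z1 z2 : 0 < e ->
  `|complex.Im (z1 * z2)| <= (e * sqnormc z1 + e^-1 * sqnormc z2) / 2.
Proof.
move=> e0; have := Re_mul_le z1 ('i * z2) e0.
have -> : sqnormc ('i * z2 : R[i]) = sqnormc z2.
  by rewrite sqnormcM /sqnormc /= expr0n expr1n add0r mul1r.
by rewrite mulrCA ReM /= mul0r mul1r sub0r normrN.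
Qed.

Lemma L2M f g : L2 f -> L2 g -> integrableC (fun x => f x * g x).
Proof.
move=> /L2P[mf fi] /L2P[mg gi]; have [mr mi] := measurableC_M mf mg.
have Hi : mu.-integrable D (EFin \o
    (fun x => 2^-1 * (sqnormc (f x) + sqnormc (g x)))).
  by apply: integrableRZl; exact: integrableRD.
split; apply: (@le_integrable _ _ R mu D measurable_circle _ _ _ _ Hi);
  try exact/measurable_EFinP.
- move=> x _ /=; rewrite lee_fin; apply: le_trans (ler_norm _).
  by have := Re_mul_le (f x) (g x) ltr01; rewrite invr1 !mul1r [leRHS]mulrC.
- move=> x _ /=; rewrite lee_fin; apply: le_trans (ler_norm _).
  by have := Im_mul_le (f x) (g x) ltr01; rewrite invr1 !mul1r [leRHS]mulrC.
Qed.

Lemma L2_integrableC f : L2 f -> integrableC f.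
Proof.
move=> fi; apply: eq_integrableC (L2M fi (L2_cst 1)) => x; exact: mulr1.
Qed.

Lemma pairing_le (e : R) f g : 0 < e -> L2 f -> L2 g ->
  `|complex.Re (integralC (fun x => f x * g x))| <=
    (e * L2sqnorm f + e^-1 * L2sqnorm g) / 2 /\
  `|complex.Im (integralC (fun x => f x * g x))| <=
    (e * L2sqnorm f + e^-1 * L2sqnorm g) / 2.
Proof.
move=> e0 f2 g2; have [/L2P[_ fi] /L2P[_ gi]] := (f2, g2).
have [ri ji] := L2M f2 g2.
have Hi : mu.-integrable D (EFin \o
    (fun x => 2^-1 * (e * sqnormc (f x) + e^-1 * sqnormc (g x)))).
  by apply: integrableRZl; apply: integrableRD; exact: integrableRZl.
have -> : (e * L2sqnorm f + e^-1 * L2sqnorm g) / 2 = \int[mu]_(x in D)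
    (2^-1 * (e * sqnormc (f x) + e^-1 * sqnormc (g x))).
  rewrite RintegralZl//; last first.
    by apply: integrableRD; exact: integrableRZl.
  rewrite RintegralD//; [|exact: integrableRZl|exact: integrableRZl].
  by rewrite !RintegralZl// mulrC.
split; (apply: le_trans (le_normr_Rintegral _ _) _ => //;
  apply: le_Rintegral => //; first exact: integrable_norm).
- by move=> x _ /=; rewrite [leRHS]mulrC; exact: Re_mul_le.
- by move=> x _ /=; rewrite [leRHS]mulrC; exact: Im_mul_le.
Qed.

Definition cvgC (u : nat -> R[i]) (l : R[i]) : Prop :=
  (fun n => complex.Re (u n)) @ \oo --> complex.Re l /\
  (fun n => complex.Im (u n)) @ \oo --> complex.Im l.

Lemma cvgC_unique u k l : cvgC u k -> cvgC u l -> k = l.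
Proof.
move=> [rk ik] [rl il]; apply: complex_ext.
  exact: cvg_unique rk rl.
exact: cvg_unique ik il.
Qed.

Lemma cvgC_near u l : (\forall n \near \oo, u n = l) -> cvgC u l.
Proof.
by move=> ul; split; apply: cvg_near_cst; apply: filterS ul => n ->.
Qed.

Definition L2_cvg (F : nat -> R -> R[i]) h : Prop :=
  (fun n => sqnorm_L2 (fun x => h x - F n x)) @ \oo --> 0%E.

(** The first term of the bound is made small by the choice of [e], the second
    by that of [n]. *)
Lemma small_bound_cvg (u : nat -> R) (l A : R) (b : nat -> R) :
  0 <= A -> b @ \oo --> 0 ->
  (forall e n, 0 < e -> `|l - u n| <= (e * A + e^-1 * b n) / 2) ->
  u @ \oo --> l.
Proof.
move=> A0 b0 ub; apply/cvgrPdist_le => e e0.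
have A1 : 0 < A + 1 by rewrite ltr_wpDl.
pose d := e / (A + 1); have d0 : 0 < d by rewrite divr_gt0.
have de : 0 < d * e by rewrite mulr_gt0.
move/cvgrPdist_le : b0 => /(_ _ de); apply: filterS => n.
rewrite sub0r normrN => /(le_trans (ler_norm _)) bn.
apply: le_trans (ub d n d0) _.
rewrite ler_pdivrMr// mulr_natr mulr2n; apply: lerD.
  by rewrite /d mulrAC ler_pdivrMr// ler_pM2l// lerDl.
by rewrite ler_pdivrMl.
Qed.

(** The difference of the two pairings is the pairing of [m] with [h - F n], to
    which Young's inequality applies. *)
Lemma pairing_cvg m h (F : nat -> R -> R[i]) : L2 m -> L2 h ->
  (forall n, L2 (F n)) -> L2_cvg F h ->
  cvgC (fun n => integralC (fun x => m x * F n x))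
       (integralC (fun x => m x * h x)).
Proof.
move=> m2 h2 F2 Fh.
have d2 n : L2 (fun x => h x - F n x) by exact: L2B.
have b0 : (fun n => L2sqnorm (fun x => h x - F n x)) @ \oo --> 0.
  move/fine_cvg : Fh; apply: cvg_trans; apply: near_eq_cvg; apply: nearW => n.
  by rewrite /= sqnorm_L2E.
have E n : integralC (fun x => m x * (h x - F n x)) =
    integralC (fun x => m x * h x) - integralC (fun x => m x * F n x).
  rewrite -integralCB; [|exact: L2M|exact: L2M].
  by congr integralC; apply/funext => x; rewrite mulrBr.
split; apply: (small_bound_cvg (L2sqnorm_ge0 m) b0) => e n e0.
- by have [+ _] := pairing_le e0 m2 (d2 n); rewrite E ReD ReN.
- by have [_ +] := pairing_le e0 m2 (d2 n); rewrite E ImD ImN.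
Qed.

(** The partial sums whose limit is the value of [F^*] at [v]. *)
Definition trig v n : R -> R[i] :=
  fun x => zpsum (fun j => v j * cis (- (j%:~R * x))) n.

Lemma L2_trig v n : L2 (trig v n).
Proof.
apply: L2_zpsum => j; apply: L2Z.
under eq_fun do rewrite -mulNr -[cis _]mul1r.
by apply: L2M_cis; exact: L2_cst.
Qed.

Lemma twopiC_neq0 : (2 * pi)%:C != 0 :> R[i].
Proof.
by rewrite -(rmorph0 (real_complex R)) (inj_eq (@complexI _)) gt_eqF ?twopi_gt0.
Qed.

Lemma integralC_fourier g j :
  integralC (fun x => g x * cis (j%:~R * x)) = (2 * pi)%:C * fourier g j.
Proof.
rewrite /fourier mulrA -rmorphM mulfV ?mul1r// gt_eqF//.
exact: twopi_gt0.
Qed.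

Lemma fourier_cvg m h (F : nat -> R -> R[i]) j : L2 m -> L2 h ->
  (forall n, L2 (F n)) -> L2_cvg F h ->
  cvgC (fun n => fourier (fun x => m x * F n x) j) (fourier (fun x => m x * h x) j).
Proof.
move=> m2 h2 F2 Fh; have [] := pairing_cvg (L2M_cis j%:~R m2) h2 F2 Fh.
have E (f : R -> R[i]) : fourier (fun x => m x * f x) j = (2 * pi)^-1%:C *
  integralC (fun x => m x * cis (j%:~R * x) * f x).
  by rewrite /fourier; congr (_ * integralC _); apply/funext => x; rewrite mulrAC.
move=> rc ic; split.
- under eq_fun do rewrite E ReM /= mul0r subr0.
  by rewrite E ReM /= mul0r subr0; exact: cvgMr.
- under eq_fun do rewrite E ImM /= mul0r addr0.
  by rewrite E ImM /= mul0r addr0; exact: cvgMr.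
Qed.

(** Multiplication by an exponential shifts Fourier coefficients, so a product
    with a trigonometric sum has a finite convolution as its coefficients. *)
Lemma fourierM_trig f v n k : L2 f ->
  fourier (fun x => f x * trig v n x) k =
  zpsum (fun j => v j * fourier f (k - j)) n.
Proof.
move=> f2; rewrite /fourier.
have -> : (fun x => f x * trig v n x * cis (k%:~R * x)) =
    (fun x => zpsum (fun j => v j * (f x * cis ((k - j)%:~R * x))) n).
  apply/funext => x; rewrite /trig mulrAC -zpsumMl; apply: eq_zpsum => j _.
  rewrite mulrCA -mulrA; congr (_ * (_ * _)); rewrite -cisD; congr cis.
  by rewrite rmorphB /= mulrBl.
have fi j : integrableC (fun x => f x * cis ((k - j)%:~R * x)).
  by apply: L2_integrableC; exact: L2M_cis.
rewrite (integralC_zpsum (F := fun j x => v j * (f x * cis ((k - j)%:~R * x)))).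
  by rewrite -zpsumMl; apply: eq_zpsum => j _; rewrite integralCZ// mulrCA.
by move=> j; exact: integrableCZ.
Qed.

Lemma fourier_one j : fourier (fun=> 1) j = (j == 0)%:R :> R[i].
Proof.
apply: (mulfI twopiC_neq0); rewrite -integralC_fourier.
under [X in integralC X]eq_fun do rewrite mul1r.
have [->|j0] := eqVneq j 0; last by rewrite integralC_cis// mulr0.
under [X in integralC X]eq_fun do rewrite mul0r cis0.
by rewrite integralC_cst.
Qed.

Lemma fourier_trig v n k :
  fourier (trig v n) k = if (`|k| <= n)%N then v k else 0.
Proof.
have -> : trig v n = (fun x => 1 * trig v n x).
  by apply/funext => x; rewrite mul1r.
rewrite (@fourierM_trig (fun=> 1)); last exact: L2_cst.
under [X in zpsum X]eq_fun do rewrite fourier_one subr_eq0.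
case: ifPn => kn.
  rewrite (zpsum_delta (i := k))// ?eqxx ?mulr1// => j jk.
  by rewrite eq_sym (negbTE jk) mulr0.
rewrite (@eq_zpsum _ _ (fun=> 0)) ?zpsum_eq0// => j jn.
by case: eqP => [kj|]; rewrite ?mulr0//; move: kn; rewrite kj jn.
Qed.

Lemma integralC_conj_trig g v n : L2 g ->
  integralC (fun x => g x * (conjc (trig v n x))) =
  (2 * pi)%:C * zpsum (fun j => (conjc (v j)) * fourier g j) n.
Proof.
move=> g2.
have -> : (fun x => g x * (conjc (trig v n x))) =
    (fun x => zpsum (fun j => (conjc (v j)) * (g x * cis (j%:~R * x))) n).
  apply/funext => x; rewrite /trig (raddf_zpsum (@conjc R)) -zpsumMl.
  apply: eq_zpsum => j _ /=; rewrite conjM_cis; exact: mulrCA.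
have gi j : integrableC (fun x => g x * cis (j%:~R * x)).
  by apply: L2_integrableC; exact: L2M_cis.
rewrite (integralC_zpsum (F := fun j x => (conjc (v j)) * (g x * cis (j%:~R * x)))).
  rewrite -zpsumMl; apply: eq_zpsum => j _.
  by rewrite integralCZ// integralC_fourier mulrCA.
by move=> j; exact: integrableCZ.
Qed.

Lemma L2sqnorm_conj f : L2 f ->
  (L2sqnorm f)%:C = integralC (fun x => f x * (conjc (f x))).
Proof.
move=> f2; apply: complex_ext => /=.
- by apply: eq_Rintegral => x _; rewrite sqnormc_mul_conj.
- under eq_Rintegral do rewrite sqnormc_mul_conj.
  by rewrite /= Rintegral_circle_cst mulr0.
Qed.

Lemma L2sqnorm_trig v n :
  L2sqnorm (trig v n) = 2 * pi * zpsum (fun j => sqnormc (v j)) n.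
Proof.
have /complexI : (L2sqnorm (trig v n))%:C =
    (2 * pi * zpsum (fun j => sqnormc (v j)) n)%:C :> R[i]; last by [].
rewrite L2sqnorm_conj; last exact: L2_trig.
rewrite integralC_conj_trig; last exact: L2_trig.
rewrite [RHS]rmorphM; congr (_ * _).
rewrite (raddf_zpsum (real_complex R)); apply: eq_zpsum => j jn /=.
by rewrite fourier_trig jn -sqnormc_mul_conj mulrC.
Qed.

(** The squared distance from [g] to its partial Fourier sum is the difference
    of the two sides, up to the factor [2 * pi]. *)
Lemma bessel g n : L2 g ->
  zpsum (fun j => sqnormc (fourier g j)) n <= L2sqnorm g / (2 * pi).
Proof.
move=> g2; set v := fourier g; set S := trig v n.
have S2 : L2 S by exact: L2_trig.
have : 0 <= L2sqnorm (fun x => g x - S x) by exact: L2sqnorm_ge0.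
have [/L2P[_ gi] /L2P[_ Si]] := (g2, S2).
have [cri _] := L2M g2 (L2_conj S2).
have -> : L2sqnorm (fun x => g x - S x) =
    L2sqnorm g - 2 * complex.Re (integralC (fun x => g x * (conjc (S x)))) + L2sqnorm S.
  rewrite /L2sqnorm /= -RintegralZl// -RintegralB//; last exact: integrableRZl.
  rewrite -RintegralD//; last first.
    by apply: integrableRB => //; exact: integrableRZl.
  apply: eq_Rintegral => x _; rewrite /sqnormc.
  by case: (g x) (S x) => a b [a' b'] /=; ring.
rewrite integralC_conj_trig// L2sqnorm_trig.
have -> : zpsum (fun j => (conjc (v j)) * fourier g j) n =
    (zpsum (fun j => sqnormc (v j)) n)%:C.
  rewrite (raddf_zpsum (real_complex R)); apply: eq_zpsum => j _ /=.
  by rewrite -sqnormc_mul_conj mulrC.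
by rewrite -rmorphM /= => h; rewrite ler_pdivlMr ?twopi_gt0//; lra.
Qed.

Lemma fourier_ell2 g : L2 g -> ell2 (fourier g).
Proof. by move=> g2; apply/ell2P; exists (L2sqnorm g / (2 * pi)) => n; exact: bessel. Qed.

(** The coefficients of the partial sums are eventually [v k], and taking a
    coefficient is continuous. *)
Lemma fourier_Fstar v h : is_Fstar v h -> fourier h = v.
Proof.
move=> [_ h2 vh]; apply/funext => k.
have one (F : R -> R[i]) : fourier (fun x => 1 * F x) k = fourier F k.
  by congr (fourier _ k); apply/funext => x; rewrite mul1r.
have := @fourier_cvg (fun=> 1) h (trig v) k (L2_cst 1) h2 (L2_trig v) vh.
under eq_fun do rewrite one; rewrite one => hc.
symmetry; apply: cvgC_unique hc; apply: cvgC_near.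
by exists `|k|%N => // n /= kn; rewrite fourier_trig kn.
Qed.

End L2Space.

(** * Completeness of the real L2 space *)

Section RealL2Completeness.
Local Open Scope ereal_scope.
Context d (T : measurableType d) (R : realType).
Variables (mu : {measure set T -> \bar R}) (D : set T) (mD : measurable D).
Implicit Types f : nat -> T -> R.

Let c (k : nat) : R := (2^-1 ^+ k.+1)%R.

Let c_gt0 k : (0 < c k)%R.
Proof. by rewrite exprn_gt0. Qed.

Let sum_c : \sum_(k <oo) (c k)%:E <= 1.
Proof.
apply: le_trans (epsilon_trick0 xpredT (@ler01 R)).
apply: lee_nneseries => [k _ _|k _]; rewrite lee_fin; first exact/ltW.
by rewrite /c exprVn div1r natrX.
Qed.

Let cvg_dominated (u : nat -> R) (K : R) :
  (forall k, `|u k.+1 - u k| <= c k * K)%R -> cvgn u.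
Proof.
move=> uK; have K0 : (0 <= K)%R.
  by rewrite -(pmulr_rge0 K (c_gt0 0)) (le_trans _ (uK 0%N)).
have : cvgn (series (telescope u)).
  apply: normed_cvg; apply: (@series_le_cvg _ _ (fun k => c k * K)%R) => //.
    by move=> k; exact: normr_ge0.
    by move=> k; rewrite mulr_ge0// ltW.
  rewrite (_ : (fun k => _) = geometric (2^-1 * K) 2^-1)%R; last first.
    by apply/funext => k; rewrite /= /c exprS mulrAC.
  by apply: is_cvg_geometric_series; rewrite ger0_norm// invf_lt1// ltr1n.
move=> /cvg_ex[l]; rewrite telescopeK => ul; apply/cvg_ex; exists (l + u 0%N)%R.
suff : (fun n => u n - u 0%N + u 0%N)%R @ \oo --> (l + u 0%N)%R.
  by under eq_fun do rewrite subrK.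
by apply: cvgD => //; exact: cvg_cst.
Qed.

(** The series [G] of the squared increments weighted by [c k ^- 2] has a finite
    integral, hence is finite almost everywhere. Where it is finite, the
    increments are at most [c k * (1 + G) / 2], a summable geometric bound. *)
Lemma fast_cauchy_ae_cvg f :
  (forall n, measurable_fun D (f n)) ->
  (forall k, \int[mu]_(x in D) ((f k.+1 x - f k x) ^+ 2)%:E <= (c k ^+ 3)%:E) ->
  {ae mu, forall x, D x -> cvgn (f ^~ x)}.
Proof.
move=> mf fc.
pose g k x : \bar R := ((c k ^- 2) * (f k.+1 x - f k x) ^+ 2)%:E.
have mg k : measurable_fun D (g k).
  apply/measurable_EFinP; apply: measurable_funM => //.
  by apply: measurable_funX; exact: measurable_funB.
have g0 k x : D x -> 0 <= g k x.
  by move=> _; rewrite lee_fin mulr_ge0 ?sqr_ge0// invr_ge0 sqr_ge0.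
pose G x := \sum_(k <oo) g k x.
have iG : mu.-integrable D G.
  apply/integrableP; split.
    by apply: ge0_emeasurable_sum => // k x Dx _; exact: g0.
  rewrite (@eq_integral _ _ _ _ _ G); last first.
    move=> x /set_mem Dx; rewrite gee0_abs//.
    by apply: nneseries_ge0 => k _ _; exact: g0.
  rewrite integral_nneseries//; apply: le_lt_trans (ltry 1).
  apply: le_trans sum_c; apply: lee_nneseries => [k _ _|k _].
    exact: integral_ge0 (g0 k).
  rewrite /g; under eq_integral do rewrite EFinM.
  rewrite ge0_integralZl//; last 3 first.
  - apply/measurable_EFinP.
    by apply: measurable_funX; exact: measurable_funB.
  - by move=> x _; rewrite lee_fin sqr_ge0.
  - by rewrite lee_fin invr_ge0 sqr_ge0.
  apply: le_trans (lee_wpmul2l _ (fc k)) _.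
    by rewrite lee_fin invr_ge0 sqr_ge0.
  rewrite -EFinM lee_fin; have := c_gt0 k; move: (c k) => b b0.
  by rewrite (_ : b ^- 2 * b ^+ 3 = b)%R//; field; rewrite gt_eqF.
have := integrable_ae mD iG; apply: filterS => x /[swap] Dx /(_ Dx) Gx.
apply: (@cvg_dominated _ (2^-1 * (1 + fine (G x)))%R) => k.
have gG : (c k ^- 2 * (f k.+1 x - f k x) ^+ 2 <= fine (G x))%R.
  rewrite -lee_fin fineK//; apply: le_trans (_ : \sum_(0 <= i < k.+1) g i x <= _).
    rewrite big_nat_recr//= leeDr// sume_ge0// => i _; exact: g0.
  by apply: nneseries_lim_ge => i _ _; exact: g0.
set a := (f k.+1 x - f k x)%R in gG *.
have := mulr_ge0 (ltW (c_gt0 k)) (sqr_ge0 ((c k)^-1 * `|a| - 1)%R).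
have -> : (c k * ((c k)^-1 * `|a| - 1) ^+ 2 =
    c k * (1 + c k ^- 2 * `|a| ^+ 2) - 2 * `|a|)%R.
  by field; rewrite gt_eqF.
have := ler_wpM2l (ltW (c_gt0 k)) gG.
rewrite -normrX [(`|a ^+ 2|)%R]ger0_norm ?sqr_ge0//.
move: (c k ^- 2 * a ^+ 2)%R => y; lra.
Qed.

(** A rapidly Cauchy subsequence converges almost everywhere; its limit is the
    limit of the whole sequence by Fatou's lemma. *)
Lemma real_L2_complete f :
  (forall n, measurable_fun D (f n)) ->
  (forall e, (0 < e)%R -> exists N, forall m n, (N <= m)%N -> (N <= n)%N ->
     \int[mu]_(x in D) ((f m x - f n x) ^+ 2)%:E <= e%:E) ->
  exists2 h : T -> R, measurable_fun D h &
  forall e, (0 < e)%R -> exists N, forall n, (N <= n)%N ->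
     \int[mu]_(x in D) ((h x - f n x) ^+ 2)%:E <= e%:E.
Proof.
move=> mf fC.
have [N NP] := choice (fun k => fC (c k ^+ 3)%R (exprn_gt0 3 (c_gt0 k))).
(* The subsequence dominates all the moduli [N i] with [i <= k], and its own
   index [k]. *)
pose s k := (\sum_(i < k.+1) (N i).+1)%N.
have sS k : (s k <= s k.+1)%N by rewrite /s [leqRHS]big_ord_recr leq_addr.
have Ns k : (N k <= s k)%N.
  by rewrite /s big_ord_recr /= (leq_trans (leqnSn _))// leq_addl.
have ks k : (k <= s k)%N.
  apply: (@leq_trans (\sum_(i < k.+1) 1)%N); last exact: leq_sum.
  by rewrite sum1_card card_ord.
have ae : {ae mu, forall x, D x -> cvgn (fun k => f (s k) x)}.
  apply: fast_cauchy_ae_cvg => // k; apply: NP => //.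
  exact: leq_trans (Ns k) (sS k).
(* The upper limit is measurable everywhere and agrees with the limit where that
   exists. *)
pose h x := fine (limn_esup (fun k => (f (s k) x)%:E)).
have mh : measurable_fun D h.
  apply: (measurableT_comp (f := fine)) => //.
  by apply: measurable_fun_limn_esup => k; exact/measurable_EFinP.
have hl x l : (fun k => f (s k) x) @ \oo --> l -> h x = l.
  move=> fl; have : (fun k => (f (s k) x)%:E) @ \oo --> l%:E.
    by apply: cvg_EFin => //; exact: nearW.
  by move=> /cvg_limn_einf_sup[_]; rewrite /h => ->.
exists h => // e e0; have [M MP] := fC e e0; exists M => n Mn.
pose q k x : \bar R := ((f (s (M + k)%N) x - f n x) ^+ 2)%:E.
have mq k : measurable_fun D (q k).
  by apply/measurable_EFinP; apply: measurable_funX; exact: measurable_funB.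
have q0 k x : D x -> 0 <= q k x by move=> _; rewrite lee_fin sqr_ge0.
rewrite (@ae_eq_integral _ _ _ mu D (fun x => limn_einf (q ^~ x)))//; last 3 first.
- by apply/measurable_EFinP; apply: measurable_funX; exact: measurable_funB.
- rewrite /limn_einf; apply: measurableT_comp => //.
  apply: measurable_fun_limn_esup => k; exact: measurableT_comp.
- apply: filterS ae => x /[swap] Dx /(_ Dx) /cvg_ex[l fl].
  rewrite (hl _ _ fl).
  suff /cvg_limn_einf_sup[-> _] : q ^~ x @ \oo --> ((l - f n x) ^+ 2)%:E by [].
  apply: cvg_EFin; first exact: nearW.
  rewrite /comp /q /=.
  have fl' : (fun k => f (s (M + k)%N) x) @ \oo --> l.
    move: fl; rewrite -(cvg_shiftn M) /=.
    by under eq_fun do rewrite addnC.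
  under eq_fun do rewrite expr2.
  by rewrite expr2; apply: cvgM; apply: cvgB => //; exact: cvg_cst.
apply: le_trans (fatou mu mD mq q0) _.
rewrite limn_einf_lim; apply: lime_le; first exact: is_cvg_einfs.
apply: nearW => k; apply: le_trans (_ : \int[mu]_(x in D) q k x <= _).
  by apply: ereal_inf_lbound; exists k => //=.
apply: MP => //; apply: leq_trans (ks _); exact: leq_addr.
Qed.

End RealL2Completeness.

(** * The Riesz-Fischer theorem *)

Section RieszFischer.
Local Open Scope complex_scope.
Context {R : realType}.
Local Notation mu := (@lebesgue_measure R).
Local Notation D := (@circle R).
Implicit Types (h : R -> R[i]) (v : int -> R[i]).

Local Hint Extern 0 (measurable _) => exact: measurable_circle : core.

Lemma zpsum_tail (V : zmodType) (F : int -> V) m n : (m <= n)%N ->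
  zpsum (fun j => if (`|j| <= m)%N then 0 else F j) n = zpsum F n - zpsum F m.
Proof.
move=> mn.
have <- : zpsum (fun j => if (`|j| <= m)%N then F j else 0) n = zpsum F m.
  rewrite (zpsum_supp _ mn); first by apply: eq_zpsum => j ->.
  by move=> j; rewrite ltnNge => /negbTE ->.
rewrite -zpsumB; apply: eq_zpsum => j _.
by case: ifP; rewrite ?subrr ?subr0.
Qed.

Lemma L2sqnorm_trigB v m n : (m <= n)%N ->
  L2sqnorm (fun x => trig v n x - trig v m x) =
  2 * pi * (zpsum (fun j => sqnormc (v j)) n - zpsum (fun j => sqnormc (v j)) m).
Proof.
move=> mn; pose w j := if (`|j| <= m)%N then 0 else v j.
have -> : (fun x => trig v n x - trig v m x) = trig w n.
  apply/funext => x; rewrite /trig -zpsum_tail//; apply: eq_zpsum => j _.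
  by rewrite /w; case: ifP; rewrite ?mul0r.
rewrite L2sqnorm_trig -zpsum_tail//; congr (_ * _); apply: eq_zpsum => j _.
by rewrite /w; case: ifP => // _; rewrite /sqnormc /= expr0n addr0.
Qed.

Lemma trig_cauchy v : ell2 v -> forall e, 0 < e -> exists N, forall m n,
  (N <= m)%N -> (N <= n)%N -> L2sqnorm (fun x => trig v n x - trig v m x) <= e.
Proof.
move=> /ell2P[K vK] e e0; set S := zpsum (fun j => sqnormc (v j)) in vK.
have Snd : nondecreasing_seq S.
  by move=> m n mn; apply: zpsum_mono => // j; exact: sqnormc_ge0.
have Sub : has_ubound (range S) by exists K => _ [n _ <-]; exact: vK.
have Scv := nondecreasing_is_cvgn Snd Sub.
have Sle n : S n <= limn S by exact: nondecreasing_cvgn_le.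
have e1 : 0 < e / (2 * pi) by rewrite divr_gt0// twopi_gt0.
move/cvgrPdist_le : Scv => /(_ _ e1)[N _ NS]; exists N.
suff H m n : (N <= m)%N -> (m <= n)%N ->
    L2sqnorm (fun x => trig v n x - trig v m x) <= e.
  move=> m n Nm Nn; have [mn|/ltnW nm] := leqP m n; first exact: H.
  rewrite (_ : L2sqnorm _ = L2sqnorm (fun x => trig v m x - trig v n x)); first exact: H.
  apply: eq_Rintegral => x _; rewrite -opprB /sqnormc ReN ImN !sqrrN//.
move=> Nm mn; rewrite L2sqnorm_trigB// -ler_pdivlMl ?twopi_gt0// mulrC.
apply: le_trans (NS m Nm); rewrite ger0_norm ?subr_ge0 ?Sle//.
by rewrite lerB// Sle.
Qed.

Lemma le_part_sqnorm (q : R -> R) h : L2 h -> measurable_fun D q ->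
  (forall x, q x ^+ 2 <= sqnormc (h x)) ->
  (\int[mu]_(x in D) (q x ^+ 2)%:E <= (L2sqnorm h)%:E)%E.
Proof.
move=> h2 mq qh; rewrite -sqnorm_L2E// sqnorm_L2_sqnormc.
apply: ge0_le_integral => //=.
- by move=> x _; rewrite lee_fin sqr_ge0.
- by apply/measurable_EFinP; exact: measurable_funX.
- by apply/measurable_EFinP; apply: measurable_sqnormc; exact: L2_measurable.
- by move=> x _; rewrite lee_fin.
Qed.

(** By Parseval's identity the partial sums of [v] are Cauchy; the limits of their
    real and imaginary parts are taken separately. *)
Lemma Fstar_exists v : ell2 v -> exists h, is_Fstar v h.
Proof.
move=> v2; have vC := trig_cauchy v2.
have mt n : measurableC (trig v n) by apply: L2_measurable; exact: L2_trig.
have d2 m n : L2 (fun x => trig v n x - trig v m x).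
  by apply: L2B; exact: L2_trig.
have [a ma aP] : exists2 a : R -> R, measurable_fun D a &
  forall e, (0 < e)%R -> exists N, forall n, (N <= n)%N ->
   (\int[mu]_(x in D) ((a x - complex.Re (trig v n x)) ^+ 2)%:E <= e%:E)%E.
  apply: (@real_L2_complete _ _ R mu D measurable_circle
    (fun n x => complex.Re (trig v n x))) => [n|e e0]; first by have [] := mt n.
  have [N NP] := vC e e0; exists N => m n Nm Nn.
  apply: le_trans
    (_ : ((L2sqnorm (fun x => trig v m x - trig v n x))%:E <= _)%E); last first.
    by rewrite lee_fin NP.
  apply: le_part_sqnorm => //.
    by apply: measurable_funB; [have [] := mt m|have [] := mt n].
  by move=> x; rewrite /sqnormc ReD ReN lerDl sqr_ge0.
have [b mb bP] : exists2 b : R -> R, measurable_fun D b &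
  forall e, (0 < e)%R -> exists N, forall n, (N <= n)%N ->
   (\int[mu]_(x in D) ((b x - complex.Im (trig v n x)) ^+ 2)%:E <= e%:E)%E.
  apply: (@real_L2_complete _ _ R mu D measurable_circle
    (fun n x => complex.Im (trig v n x))) => [n|e e0]; first by have [] := mt n.
  have [N NP] := vC e e0; exists N => m n Nm Nn.
  apply: le_trans
    (_ : ((L2sqnorm (fun x => trig v m x - trig v n x))%:E <= _)%E); last first.
    by rewrite lee_fin NP.
  apply: le_part_sqnorm => //.
    by apply: measurable_funB; [have [] := mt m|have [] := mt n].
  by move=> x; rewrite /sqnormc ImD ImN lerDr sqr_ge0.
pose h x := a x +i* b x; exists h.
have mh n : measurableC (fun x => h x - trig v n x).
  split; under eq_fun do rewrite ?ReD ?ImD ?ReN ?ImN /=.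
    by apply: measurable_funB => //; have [] := mt n.
  by apply: measurable_funB => //; have [] := mt n.
have hP e : 0 < e -> exists N, forall n, (N <= n)%N ->
    (sqnorm_L2 (fun x => (h x - trig v n x)%R) <= e%:E)%E.
  move=> e0; have e2 : 0 < e / 2 by rewrite divr_gt0.
  have [[N1 N1P] [M2 M2P]] := (aP _ e2, bP _ e2).
  exists (maxn N1 M2) => n; rewrite geq_max => /andP[n1 n2].
  rewrite sqnorm_L2_sqnormc [in leRHS](splitr e) EFinD.
  apply: le_trans (leeD (N1P _ n1) (M2P _ n2)).
  rewrite -ge0_integralD//; last 4 first.
  - by move=> x _; rewrite lee_fin sqr_ge0.
  - apply/measurable_EFinP; apply: measurable_funX.
    by apply: measurable_funB => //; have [] := mt n.
  - by move=> x _; rewrite lee_fin sqr_ge0.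
  - apply/measurable_EFinP; apply: measurable_funX.
    by apply: measurable_funB => //; have [] := mt n.
  rewrite le_eqVlt; apply/orP; left; apply/eqP; apply: eq_integral => x _.
  by rewrite -EFinD /sqnormc ReD ImD ReN ImN.
have hd2 n : L2 (fun x => h x - trig v n x).
  have [N NP] := hP 1 ltr01.
  have l2N : L2 (fun x => h x - trig v N x).
    by have [rm im] := mh N; split => //; apply: le_lt_trans (NP N (leqnn N)) (ltry _).
  rewrite (_ : (fun x => _) =
    (fun x => (h x - trig v N x) - (trig v n x - trig v N x))); first exact: L2B.
  by apply/funext => x; rewrite opprB addrA subrK.
have h2 : L2 h.
  rewrite (_ : h = (fun x => (h x - trig v 0 x) + trig v 0 x)).
    by apply: L2D => //; exact: L2_trig.
  by apply/funext => x; rewrite subrK.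
split => //.
suff : (fun n => sqnorm_L2 (fun x => h x - trig v n x)) @ \oo --> 0%E by [].
have -> : (fun n => sqnorm_L2 (fun x => h x - trig v n x)) =
  EFin \o (fun n => L2sqnorm (fun x => h x - trig v n x)).
  by apply/funext => n /=; rewrite sqnorm_L2E.
apply: cvg_EFin; first exact: nearW.
apply/cvgrPdist_le => e e0; have [N NP] := hP e e0; exists N => // n /= Nn.
rewrite sub0r normrN ger0_norm ?L2sqnorm_ge0// -lee_fin -sqnorm_L2E//.
exact: NP.
Qed.

End RieszFischer.

(** * Uniqueness of Fourier coefficients for integrable functions *)

Section FourierUniqueness.
Local Open Scope complex_scope.
Context {R : realType}.
Local Notation mu := (@lebesgue_measure R).
Local Notation D := (@circle R).
Implicit Types (f : R -> R[i]) (u : R -> R).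

Local Hint Extern 0 (measurable _) => exact: measurable_circle : core.

(** The functions with vanishing Fourier coefficients form a space stable under
    multiplication by trigonometric polynomials. This avoids any explicit algebra
    of such polynomials. *)
Definition fourier_null f : Prop :=
  integrableC f /\ forall j : int, integralC (fun x => f x * cis (j%:~R * x)) = 0.

Lemma fourier_nullZ z f : fourier_null f -> fourier_null (fun x => z * f x).
Proof.
move=> [fi f0]; split=> [|j]; first exact: integrableCZ.
under [X in integralC X]eq_fun do rewrite -mulrA.
by rewrite integralCZ ?f0 ?mulr0//; exact: integrableCM_cis.
Qed.

Lemma fourier_nullD f g : fourier_null f -> fourier_null g ->
  fourier_null (fun x => f x + g x).
Proof.
move=> [fi f0] [gi g0]; split=> [|j]; first exact: integrableCD.
under [X in integralC X]eq_fun do rewrite mulrDl.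
rewrite integralCD ?f0 ?g0 ?addr0//; exact: integrableCM_cis.
Qed.

Lemma fourier_nullM_cis f (i : int) : fourier_null f ->
  fourier_null (fun x => f x * cis (i%:~R * x)).
Proof.
move=> [fi f0]; split=> [|j]; first exact: integrableCM_cis.
under [X in integralC X]eq_fun do rewrite -mulrA -cisD -mulrDl -rmorphD.
exact: f0.
Qed.

Lemma fourier_nullM_cos f (c : R) : fourier_null f ->
  fourier_null (fun x => (cos (x - c))%:C * f x).
Proof.
move=> f0.
have := fourier_nullD
  (fourier_nullZ (cis (- c) / 2) (fourier_nullM_cis 1 f0))
  (fourier_nullZ (cis c / 2) (fourier_nullM_cis (-1) f0)).
congr (fourier_null _); apply/funext => x.
rewrite mulrN1z mulr1z mulN1r mul1r.
have -> : (cos (x - c))%:C = (cis (- c) * cis x + cis c * cis (- x)) / 2 :> R[i].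
  rewrite -!cisD [- c + x]addrC -[c - x]opprB.
  apply: (mulIf (x := 2)); first by rewrite pnatr_eq0.
  rewrite mulfVK ?pnatr_eq0//; apply: complex_ext.
    by rewrite ReM ReD /= cosN; ring.
  by rewrite ImM ImD /= sinN; ring.
by field.
Qed.

(** For a suitable height [a] it exceeds 1/2 exactly on an arc centred at [c]. *)
Definition peak (a c x : R) : R := a * (1 + cos (x - c)).

Lemma fourier_nullM_peak f a c n N : fourier_null f ->
  fourier_null (fun x => ((1 - peak a c x ^+ n) ^+ N)%:C * f x).
Proof.
have one g : fourier_null g -> fourier_null (fun x => (peak a c x)%:C * g x).
  move=> g0; have := fourier_nullZ a%:C (fourier_nullD g0 (fourier_nullM_cos c g0)).
  congr (fourier_null _); apply/funext => x.
  by rewrite /peak rmorphM rmorphD rmorph1; ring.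
have pow k g : fourier_null g -> fourier_null (fun x => (peak a c x ^+ k)%:C * g x).
  move=> g0; elim: k => [|k /one].
    by under eq_fun do rewrite expr0 rmorph1 mul1r.
  by under eq_fun do rewrite mulrA -rmorphM -exprS.
move=> f0; elim: N => [|N IH].
  by under eq_fun do rewrite expr0 rmorph1 mul1r.
have := fourier_nullD IH (fourier_nullZ (-1) (pow n _ IH)).
congr (fourier_null _); apply/funext => x.
by rewrite exprS rmorphM rmorphB rmorph1; ring.
Qed.

(** The real form in which the vanishing of the coefficients is used. The
    exponents [0] give the vanishing of the integral of [u] itself. *)
Definition peak_null u : Prop := mu.-integrable D (EFin \o u) /\
  forall a c n N, \int[mu]_(x in D) ((1 - peak a c x ^+ n) ^+ N * u x) = 0.

Lemma fourier_null_peak f : fourier_null f ->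
  peak_null (fun x => complex.Re (f x)) /\ peak_null (fun x => complex.Im (f x)).
Proof.
move=> f0; have [[rf jf] _] := f0.
have H a c n N : integralC (fun x => ((1 - peak a c x ^+ n) ^+ N)%:C * f x) = 0.
  have [_ /(_ 0)] := fourier_nullM_peak a c n N f0.
  by under [X in integralC X]eq_fun do rewrite mul0r cis0 mulr1.
split; split => // a c n N; have := H a c n N; rewrite /integralC => -[hr hi].
- rewrite -[RHS]hr; apply: eq_Rintegral => x _; rewrite ReM /= mul0r subr0//.
- rewrite -[RHS]hi; apply: eq_Rintegral => x _; rewrite ImM /= mul0r addr0//.
Qed.

Lemma bernoulli_ineq (y : R) n : -1 <= y -> 1 + n%:R * y <= (1 + y) ^+ n.
Proof.
move=> y1; elim: n => [|n IH]; first by rewrite mul0r addr0.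
have y0 : 0 <= 1 + y by lra.
rewrite exprS; apply: le_trans (ler_wpM2l y0 IH).
have := mulr_ge0 (ler0n R n) (sqr_ge0 y); rewrite -natr1; lra.
Qed.

(** By Bernoulli's inequality the sequence is at least [1 - (2 * p) ^+ n]. *)
Lemma cvg_one_minus_pow_lt (p : R) : 0 <= p -> 2 * p < 1 ->
  (fun n => (1 - p ^+ n) ^+ (2 ^ n)) @ \oo --> (1 : R).
Proof.
move=> p0 p2; have p1 : p <= 1 by lra.
have pn n : 0 <= p ^+ n <= 1 by rewrite exprn_ge0//= exprn_ile1.
apply: (@squeeze_cvgr _ _ _ _ (fun n => 1 - (2 * p) ^+ n) (cst 1)).
- apply: nearW => n; have /andP[a b] := pn n; apply/andP; split.
    have := @bernoulli_ineq (- p ^+ n) (2 ^ n); rewrite lerN2 => /(_ b).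
    by rewrite natrX mulrN -exprMn.
  by rewrite exprn_ile1 ?subr_ge0// gerBl.
- rewrite -[X in _ --> X]subr0; apply: cvgB; first exact: cvg_cst.
  by apply: cvg_expr; rewrite ger0_norm ?mulr_ge0.
- exact: cvg_cst.
Qed.

(** For [y = p ^+ n], Bernoulli's inequality gives
    [(1 - y) ^+ N * (1 + N * y) <= (1 - y ^+ 2) ^+ N <= 1], so the sequence is at
    most [(2 * p)^-1 ^+ n]. *)
Lemma cvg_one_minus_pow_gt (p : R) : p <= 1 -> 1 < 2 * p ->
  (fun n => (1 - p ^+ n) ^+ (2 ^ n)) @ \oo --> (0 : R).
Proof.
move=> p1 p2; have p0 : 0 <= p by lra.
have pn n : 0 <= p ^+ n <= 1 by rewrite exprn_ge0//= exprn_ile1.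
apply: (@squeeze_cvgr _ _ _ _ (cst 0) (fun n => (2 * p)^-1 ^+ n)).
- apply: nearW => n; have /andP[a b] := pn n; apply/andP; split.
    by rewrite exprn_ge0// subr_ge0.
  set y := p ^+ n in a b *.
  have q0 : 0 < (2 * p) ^+ n by rewrite exprn_gt0//; lra.
  rewrite exprVn -[leRHS]mul1r ler_pdivlMr//.
  apply: (@le_trans _ _ ((1 - y) ^+ (2 ^ n) * (1 + y) ^+ (2 ^ n))).
    rewrite ler_wpM2l ?exprn_ge0 ?subr_ge0//.
    have -> : (2 * p) ^+ n = (2 ^ n)%:R * y by rewrite natrX -exprMn.
    apply: le_trans (bernoulli_ineq (2 ^ n) _); last lra.
    by rewrite lerDr.
  rewrite -exprMn -subr_sqr expr1n exprn_ile1 ?gerBl ?sqr_ge0//.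
  by rewrite subr_ge0 exprn_ile1.
- exact: cvg_cst.
- apply: cvg_expr; rewrite ger0_norm ?invr_ge0 ?mulr_ge0//.
  by rewrite invf_lt1//; lra.
Qed.

Lemma ball_sub_circle (c h : R) : 0 <= c - h -> c + h <= 2 * pi ->
  ball c h `<=` D.
Proof.
move=> ch0 chpi; have H (x : R) : `|c - x| < h -> D x.
  rewrite ltr_norml => /andP[x1 x2].
  have x0 : 0 <= x by lra.
  have x3 : x < 2 * pi by lra.
  by rewrite /circle /= in_itv /= x0 x3.
exact: H.
Qed.

Section Ball.
Variables (c h : R).
Hypotheses (h_gt0 : 0 < h) (h_le : h <= pi / 2).
Hypotheses (ch0 : 0 <= c - h) (chpi : c + h < 2 * pi).

Let cosh_ge0 : 0 <= cos h.
Proof.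
have ? := h_gt0; have ? := h_le; have ? := ch0; have ? := chpi.
have A : - (pi / 2) <= h by lra.
by apply: cos_ge0_pihalf; rewrite A h_le. Qed.

Let cos_in x : `|x - c| < h -> cos h < cos (x - c).
Proof.
have ? := h_gt0; have ? := h_le; have ? := ch0; have ? := chpi.
move=> xc; have h1 : `|x - c| <= pi by lra.
have h2 : h <= pi by lra.
by rewrite -[X in _ < X]cos_norm ltr_cos// in_itv /= ?normr_ge0 ?h1// ltW.
Qed.

Let cos_out (x : R) : D x -> h < `|x - c| -> cos (x - c) < cos h.
Proof.
have ? := h_gt0; have ? := h_le; have ? := ch0; have ? := chpi.
rewrite /circle /= in_itv /= => /andP[xge0 xlt2] xc.
have x0 : 0 <= x := xge0; have x2 : x < 2 * pi := xlt2.
rewrite -[X in X < _]cos_norm.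
have u2 : `|x - c| < 2 * pi - h by rewrite ltr_norml; apply/andP; split; lra.
have h2 : h <= pi by lra.
have h0 : 0 <= h by lra.
have [xpi|xpi] := leP `|x - c| pi.
  by rewrite ltr_cos// in_itv /= ?normr_ge0 ?h0.
rewrite -[X in X < _]cosN -(@cosD2pi R (- `|x - c|)) -mulr_natl.
have h3 : 0 <= - `|x - c| + 2 * pi by lra.
have h4 : - `|x - c| + 2 * pi <= pi by lra.
have h5 : h < - `|x - c| + 2 * pi by lra.
by rewrite ltr_cos// in_itv /= ?h0 ?h3.
Qed.

(* The height for which [peak] is 1/2 at the endpoints of the ball. *)
Let a : R := (2 * (1 + cos h))^-1.

Let peakE x : 2 * peak a c x = (1 + cos (x - c)) / (1 + cos h).
Proof. have ? := cosh_ge0. by rewrite /peak /a; field; rewrite gt_eqF//; lra. Qed.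

Let peak_ge0 x : 0 <= peak a c x.
Proof. have ? := cosh_ge0.
apply: mulr_ge0; last by have := cos_geN1 (x - c); lra.
by rewrite invr_ge0; lra.
Qed.

Let peak_le1 x : peak a c x <= 1.
Proof. have ? := cosh_ge0.
suff : 2 * peak a c x <= 2 by lra.
rewrite peakE ler_pdivrMr; last lra.
by have := cos_le1 (x - c); lra.
Qed.

(** The trigonometric polynomials [(1 - peak ^+ n) ^+ (2 ^ n)] take values in
    [0, 1] and tend to 0 inside the ball and to 1 outside its closure. Hence the
    integral of [u] over the complement of the ball vanishes; so does the
    integral over the circle, the polynomial being constant for [N = 0]. *)
Lemma peak_null_ball u : peak_null u -> \int[mu]_(x in ball c h) u x = 0.
Proof.
move=> [ui u0].
pose phi n x := (1 - peak a c x ^+ n) ^+ (2 ^ n).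
have phi01 n x : 0 <= phi n x <= 1.
  have p0 := peak_ge0 x; have p1 := peak_le1 x.
  by rewrite exprn_ge0 ?exprn_ile1 ?subr_ge0 ?gerBl ?exprn_ile1 ?exprn_ge0.
have mu_ : measurable_fun D u by apply/measurable_EFinP; exact: measurable_int ui.
have mphi n : measurable_fun D (phi n).
  apply: measurable_funX; apply: measurable_funB => //.
  apply: measurable_funX; apply: measurable_funM => //.
  apply: measurable_funD => //; apply: measurable_funTS.
  apply: (measurableT_comp (f := @cos R)); last exact: measurable_funB.
  by apply: continuous_measurable_fun; exact: continuous_cos.
have mB : measurable (ball c h) by exact: measurable_ball.
have uB : mu.-integrable D (EFin \o (fun x => \1_(ball c h) x * u x)).
  apply: (@le_integrable _ _ R mu D measurable_circle _ _ _ _ ui).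
    by apply/measurable_EFinP; apply: measurable_funM.
  move=> x _ /=; rewrite lee_fin normrM ler_piMl//.
  by rewrite indicE; case: (_ \in _); rewrite ?normr1 ?normr0.
have iuB := integrableRB ui uB.
have [|||||_ _ dc] := @dominated_convergence _ _ R mu D measurable_circle
  (fun n x => (phi n x * u x)%:E) (fun x => (u x - \1_(ball c h) x * u x)%:E)
  (fun x => `|u x|%:E).
- by move=> n; apply/measurable_EFinP; exact: measurable_funM (mphi n) mu_.
- exact: measurable_int iuB.
- have ae_neq (y : R) : {ae mu, forall x, x != y}.
    exists [set y]; split; [exact: measurable_set1|exact: lebesgue_measure_set1|].
    by move=> x /= /negP; rewrite negbK => /eqP.
  have FF : Filter (almost_everywhere mu) := ae_filter_ringOfSetsType mu.
  apply: filterS2 (ae_neq (c - h)) (ae_neq (c + h)) => x x1 x2 Dx.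
  apply: cvg_EFin; first exact: nearW.
  rewrite [X in _ --> X](_ : _ = (1 - \1_(ball c h) x) * u x); last first.
    by rewrite mulrBl mul1r.
  apply: cvgMl; rewrite indicE.
  have [xB|xB] := pselect (ball c h x).
    rewrite mem_set// subrr; apply: cvg_one_minus_pow_gt => //.
    rewrite peakE ltr_pdivlMr; last by have := cosh_ge0; lra.
    by rewrite mul1r ltrD2l cos_in// distrC.
  rewrite memNset// subr0; apply: cvg_one_minus_pow_lt => //.
  rewrite peakE ltr_pdivrMr; last by have := cosh_ge0; lra.
  rewrite mul1r ltrD2l cos_out// lt_neqAle; apply/andP; split; last first.
    by rewrite leNgt distrC; apply/negP.
  apply/negP => /eqP hx; have [xc|xc] := leP 0 (x - c).
    by move: hx x2; rewrite ger0_norm// => ->; rewrite addrC subrK eqxx.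
  by move: hx x1; rewrite ltr0_norm// => ->; rewrite opprK addrC subrK eqxx.
- exact: integrable_norm ui.
- apply: aeW => x n _; rewrite lee_fin normrM ler_piMl//.
  by have /andP[? ?] := phi01 n x; rewrite ger0_norm.
have {}dc : (fun n => \int[mu]_(x in D) (phi n x * u x)) @ \oo -->
    \int[mu]_(x in D) (u x - \1_(ball c h) x * u x).
  apply: fine_cvg; rewrite fineK//.
  exact: (@integrable_fin_num _ _ R mu _ measurable_circle _ iuB).
have : \int[mu]_(x in D) (u x - \1_(ball c h) x * u x) = 0.
  apply: (cvg_unique (@norm_hausdorff _ _) dc); apply: cvg_near_cst.
  by apply: nearW => n; exact: u0.
rewrite RintegralB//.
have -> : \int[mu]_(x in D) u x = 0.
  rewrite -[RHS](u0 0 0 0%N 0%N); apply: eq_Rintegral => x _.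
  by rewrite expr0 mul1r.
move=> /eqP; rewrite sub0r oppr_eq0 => /eqP uB0.
have BD := ball_sub_circle ch0 (ltW chpi).
have -> : ball c h = D `&` ball c h by rewrite setIidr.
rewrite Rintegral_mkcondr -[RHS]uB0; apply: eq_Rintegral => x _.
by rewrite patchE indicE; case: ifP => _; rewrite ?mul1r ?mul0r.
Qed.

End Ball.

(** The averages of [u] on small balls vanish, and they converge to [u] almost
    everywhere by Lebesgue's differentiation theorem. *)
Lemma peak_null_ae0 u : peak_null u -> ae_eq mu D u (fun=> 0).
Proof.
move=> u0; have [ui _] := u0.
pose g := u \_ D.
have gi : mu.-integrable setT (EFin \o g).
  by rewrite -restrict_EFin; apply: (@integrable_mkcond _ _ R mu D _ measurable_circle).1.
have gl : locally_integrable setT g by apply: open_integrable_locally => //; exact: openT.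
pose E (x : R) (n : nat) : set R := ball x n.+1%:R^-1.
have hE x : nicely_shrinking x (E x).
  split; first by move=> n; exact: measurable_ball.
  exists (1, fun n => (n.+1%:R^-1)%:pos); split => //=.
  - exact: cvg_harmonic.
  - by move=> n; rewrite /E.
  - by move=> n; rewrite mul1e.
have ae_neq0 : {ae mu, forall x : R, x != 0}.
  exists [set 0]; split; [exact: measurable_set1|exact: lebesgue_measure_set1|].
  by move=> x /= /negP; rewrite negbK => /eqP.
have FF : Filter (almost_everywhere mu) := ae_filter_ringOfSetsType mu.
apply: filterS2 ae_neq0 (lebesgue_differentiation gl) => x xn0 xl Dx.
have := nice_lebesgue_differentiation hE gl xl.
have -> : g x = u x by rewrite /g patchE mem_set.
suff ev : \forall n \near \oo,
    ((mu (E x n))^-1 * \int[mu]_(y in E x n) (g y)%:E)%E = 0%E.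
  move=> gu; move: ev => /cvg_near_cst h0.
  by apply: EFin_inj; exact: (cvg_unique (@ereal_hausdorff _) gu h0).
move: Dx; rewrite /circle /= in_itv /= => /andP[xge0 xlt].
have x0 : 0 < x by rewrite lt_neqAle eq_sym xn0.
(* Below this radius the balls stay inside the circle and are short enough for
   [peak_null_ball]. *)
pose r := Num.min (Num.min x (2 * pi - x)) (pi / 2).
have r0 : 0 < r.
  by rewrite /r !lt_min x0 subr_gt0 xlt divr_gt0// pi_gt0.
have := @cvg_harmonic R; move/cvgrPdist_lt => /(_ _ r0); apply: filterS => n.
rewrite sub0r normrN /harmonic ger0_norm ?invr_ge0// /r !lt_min => /andP[/andP[n1 n2] n3].
suff -> : (\int[mu]_(y in E x n) (g y)%:E = 0)%E by rewrite mule0.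
have Bu : \int[mu]_(y in E x n) u y = 0.
  have e0 : 0 < (n.+1%:R^-1 : R) by rewrite invr_gt0.
  have e1 : (n.+1%:R^-1 : R) <= pi / 2 by exact: ltW.
  have e2 : 0 <= x - n.+1%:R^-1 by rewrite subr_ge0 ltW.
  have e3 : x + n.+1%:R^-1 < 2 * pi by rewrite -ltrBrDl.
  exact: (peak_null_ball e0 e1 e2 e3 u0).
have ED : E x n `<=` D.
  by apply: ball_sub_circle; [rewrite subr_ge0 ltW|rewrite -lerBrDl ltW].
transitivity (\int[mu]_(y in E x n) (u y)%:E)%E.
  apply: eq_integral => y /set_mem Ey; rewrite /g patchE mem_set//.
  exact: ED.
rewrite -[LHS]fineK; first by rewrite -[fine _]/(Rintegral mu (E x n) u) Bu.
apply: (@integrable_fin_num _ _ R mu _ (measurable_ball _ _)).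
exact: (@integrableS _ _ R mu _ _ _ measurable_circle (measurable_ball _ _) ED ui).
Qed.

Lemma fourier_inj0 f : integrableC f -> (forall j, fourier f j = 0) ->
  ae_eq mu D f (fun=> 0).
Proof.
move=> fi f0.
have nf : fourier_null f by split => // j; rewrite integralC_fourier f0 mulr0.
have [/peak_null_ae0 r0 /peak_null_ae0 i0] := fourier_null_peak nf.
have FF : Filter (almost_everywhere mu) := ae_filter_ringOfSetsType mu.
apply: filterS2 r0 i0 => x /[swap] hi hr Dx.
by apply: complex_ext; [exact: hr|exact: hi].
Qed.

End FourierUniqueness.

(** * Kernels, symbols and Toeplitz matrices *)

Section Kernels.
Local Open Scope complex_scope.
Context {R : realType}.
Local Notation mu := (@lebesgue_measure R).
Local Notation D := (@circle R).
Implicit Types (f g h m : R -> R[i]) (v : int -> R[i]) (A : int -> int -> R).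

Local Hint Extern 0 (measurable _) => exact: measurable_circle : core.

Lemma fourierB f g j : integrableC f -> integrableC g ->
  fourier (fun x => f x - g x) j = fourier f j - fourier g j.
Proof.
move=> fi gi; rewrite /fourier -mulrBr -integralCB; [|exact: integrableCM_cis..].
by congr (_ * integralC _); apply/funext => x; rewrite mulrBl.
Qed.

Lemma fourier_inj f g : integrableC f -> integrableC g ->
  fourier f = fourier g -> ae_eq mu D f g.
Proof.
move=> fi gi fg.
have : ae_eq mu D (fun x => f x - g x) (fun=> 0).
  apply: fourier_inj0; first exact: integrableCB.
  by move=> j; rewrite fourierB// fg subrr.
have FF : Filter (almost_everywhere mu) := ae_filter_ringOfSetsType mu.
by apply: filterS => x /[apply] /eqP; rewrite subr_eq0 => /eqP.
Qed.

Lemma eq_ae_fourier f g : integrableC f -> integrableC g ->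
  ae_eq mu D f g -> fourier f = fourier g.
Proof.
move=> fi gi fg; apply/funext => j; rewrite /fourier; congr (_ * _).
apply: integralC_ae; [exact: integrableCM_cis..|].
have FF : Filter (almost_everywhere mu) := ae_filter_ringOfSetsType mu.
by apply: filterS fg => x /[apply] ->.
Qed.

(** Completeness of the exponentials: the function built from the coefficients of
    [g] by Riesz-Fischer has the same coefficients as [g], hence equals it. *)
Lemma Fstar_fourier g : L2 g -> is_Fstar (fourier g) g.
Proof.
move=> g2; have v2 := fourier_ell2 g2; have [h hv] := Fstar_exists v2.
have [_ h2 hc] := hv.
have hg : ae_eq mu D h g.
  by apply: fourier_inj; rewrite ?(fourier_Fstar hv)//; exact: L2_integrableC.
split => //; suff : L2_cvg (trig (fourier g)) g by [].
rewrite /L2_cvg (_ : (fun n => _) =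
  (fun n => sqnorm_L2 (fun x => h x - trig (fourier g) n x)))//.
apply/funext => n; rewrite !sqnorm_L2_sqnormc.
have mt k : L2 k -> measurable_fun D (fun x => (sqnormc (k x - trig (fourier g) n x))%:E).
  move=> k2; apply/measurable_EFinP; apply: measurable_sqnormc.
  by apply: L2_measurable; apply: L2B => //; exact: L2_trig.
apply: ae_eq_integral => //; [exact: mt|exact: mt|].
have FF : Filter (almost_everywhere mu) := ae_filter_ringOfSetsType mu.
by apply: filterS hg => x /[apply] ->.
Qed.

Lemma imx_mul_delta A tau t :
  imx_mul (cplx_imx A) (fun j => (j == tau)%:R) t = (A t tau)%:C.
Proof.
rewrite /imx_mul (@zsum_delta _ _ tau) ?eqxx ?mulr1// => j /negbTE ->.
by rewrite mulr0.
Qed.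

(** The function that [fourier] maps to the [tau]-th basis vector, so that
    [F^* A F] maps it to the function whose coefficients form the [tau]-th
    column of [A]. *)
Definition character (tau : int) : R -> R[i] := fun x => cis (- (tau%:~R * x)).

Lemma L2_character tau : L2 (character tau).
Proof.
apply: (L2_le (G := fun=> 1)).
- apply: L2_measurable; have := @L2M_cis R (fun=> 1) (- tau%:~R) (L2_cst 1).
  by congr L2; apply/funext => x; rewrite mul1r mulNr.
- by case: (@integrableC_cst R 1).
- by move=> x; rewrite sqnormc_cis.
Qed.

Lemma fourierM_character f tau j :
  fourier (fun x => f x * character tau x) j = fourier f (j - tau).
Proof.
rewrite /fourier; congr (_ * integralC _); apply/funext => x.
rewrite -mulrA -cisD; congr (_ * cis _).
by rewrite rmorphB /= mulrBl addrC.
Qed.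

Lemma fourier_character tau :
  fourier (character tau) = (fun j => (j == tau)%:R).
Proof.
apply/funext => j; have := fourierM_character (fun=> 1) tau j.
under [X in fourier X]eq_fun do rewrite mul1r.
by rewrite fourier_one subr_eq0 => ->.
Qed.

(** The kernel determines the columns of the matrix through its action on the
    characters. *)
Lemma kernel_zeroP A :
  (forall t tau, A t tau = 0) <-> kernel_zero (cplx_imx A).
Proof.
split=> [A0 g g2|K0 t tau].
  exists (fun=> 0); last exact: ae_eq_refl.
  rewrite /is_FstarAF; have -> : imx_mul (cplx_imx A) (fourier g) = fun=> 0.
    apply/funext => t; rewrite /imx_mul (@zsum_delta _ _ 0) => [|j _];
    by rewrite /cplx_imx A0 mul0r.
  suff <- : fourier (fun=> 0 : R[i]) = fun=> 0 by apply: Fstar_fourier; exact: L2_cst.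
  apply/funext => j; rewrite /fourier.
  by under [X in integralC X]eq_fun do rewrite mul0r; rewrite integralC0 mulr0.
have [h hF h0] := K0 _ (L2_character tau); have [_ h2 _] := hF.
have := fourier_Fstar hF; rewrite fourier_character.
rewrite (eq_ae_fourier (L2_integrableC h2) integrableC0 h0).
move=> /(congr1 (fun v => v t)); rewrite imx_mul_delta.
rewrite /fourier; under [X in integralC X]eq_fun do rewrite mul0r.
by rewrite integralC0 mulr0 => -[].
Qed.

(** The entry [A t tau] is the coefficient of index [t] of [m * character tau],
    that is, the coefficient of [m] at [t - tau]. *)
Lemma kernel_diagonal_Toeplitz A : kernel_diagonal (cplx_imx A) -> Toeplitz A.
Proof.
move=> [m m2 mP]; exists (fun r => complex.Re (fourier m r)) => t tau.
have [h hF hm] := mP _ (L2_character tau); have [_ h2 _] := hF.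
have := fourier_Fstar hF; rewrite fourier_character.
rewrite (eq_ae_fourier (L2_integrableC h2) (L2M m2 (L2_character tau)) hm).
move=> /(congr1 (fun v => v t)); rewrite imx_mul_delta fourierM_character.
by move=> ->.
Qed.

Section Symbol.
Variables (K : R) (A : int -> int -> R).
Hypothesis AK : bounded_imx K A.

Lemma bounded_column (tau : int) (m : nat) : zpsum (fun t => A t tau ^+ 2) m <= K.
Proof.
have := AK m `|tau|%N (fun j => (j == tau)%:R).
rewrite [in leRHS](zpsum_delta (i := tau))// => [|j /negbTE ->]; last by rewrite expr0n.
rewrite eqxx expr1n mulr1; congr (_ <= _); apply: eq_zpsum => t _.
rewrite (zpsum_delta (i := tau))// => [|j /negbTE ->]; last by rewrite mulr0.
by rewrite eqxx mulr1.
Qed.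

Let K_ge0 : 0 <= K.
Proof. by apply: le_trans (bounded_column 0 0); rewrite zpsum0 sqr_ge0. Qed.

(** The bound passes from finitely supported sequences to square-summable ones,
    as soon as the products [A c] converge entrywise. *)
Lemma bounded_imx_limit (c w : int -> R) (S : R) :
  (forall n, zpsum (fun j => c j ^+ 2) n <= S) ->
  (forall t, zpsum (fun tau => A t tau * c tau) @ \oo --> w t) ->
  forall m : nat, zpsum (fun t => w t ^+ 2) m <= K * S.
Proof.
move=> cS cw m.
have lim_seq s : (fun n => \sum_(t <- s) zpsum (fun tau => A t tau * c tau) n ^+ 2)
    @ \oo --> \sum_(t <- s) w t ^+ 2.
  elim: s => [|t s IH].
    by under eq_fun do rewrite big_nil; rewrite big_nil; exact: cvg_cst.
  under eq_fun do rewrite big_cons; rewrite big_cons; apply: cvgD => //.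
  rewrite expr2; under eq_fun do rewrite expr2.
  by apply: cvgM; exact: cw.
have lim := lim_seq (window m); rewrite zpsum_window.
rewrite -(cvg_lim _ lim)//; apply: limr_le; first by apply/cvg_ex; eexists; exact: lim.
apply: nearW => n; rewrite -zpsum_window; apply: le_trans (AK m n c) _.
by rewrite ler_wpM2l.
Qed.

(** The symbol [m] has the entries of a column as its coefficients; a column is
    square-summable by boundedness. The coefficients of [m * g] are the limits of
    those of [m] times the partial sums of [g], which are exactly the symmetric
    partial sums of the product of the matrix with [fourier g]. By boundedness
    that product is square-summable, so [F^*] is defined on it, and its image
    equals the integrable function [m * g] by uniqueness of Fourier
    coefficients. *)
Lemma Toeplitz_kernel_diagonal : Toeplitz A -> kernel_diagonal (cplx_imx A).
Proof.
move=> [r rA].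
have r2 : ell2 (fun j => (r j)%:C).
  apply/ell2P; exists K => n; apply: le_trans (bounded_column 0 n).
  apply: le_zpsum => j; rewrite rA subr0 /sqnormc /= expr0n addr0//.
have [m mF] := Fstar_exists r2; have [_ m2 _] := mF.
exists m => // g g2.
pose v := fourier g; pose w := fourier (fun x => m x * g x).
have [_ _ gc] := Fstar_fourier g2.
have wlim t : cvgC (fun n => zpsum (fun tau => (A t tau)%:C * v tau) n) (w t).
  have := fourier_cvg t m2 g2 (L2_trig v) gc.
  rewrite (_ : (fun n => _) = fun n => zpsum (fun tau => (A t tau)%:C * v tau) n)//.
  apply/funext => n; rewrite fourierM_trig//; apply: eq_zpsum => tau _.
  by rewrite (fourier_Fstar mF) -rA mulrC.
have Re_w t :
    zpsum (fun tau => A t tau * complex.Re (v tau)) @ \oo --> complex.Re (w t).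
  have [+ _] := wlim t; suff -> : (fun n => complex.Re (zpsum
    (fun tau => (A t tau)%:C * v tau) n)) =
    zpsum (fun tau => A t tau * complex.Re (v tau)) by [].
  apply/funext => n.
  by rewrite Re_zpsum; apply: eq_zpsum => tau _; rewrite Re_realM.
have Im_w t :
    zpsum (fun tau => A t tau * complex.Im (v tau)) @ \oo --> complex.Im (w t).
  have [_ +] := wlim t; suff -> : (fun n => complex.Im (zpsum
    (fun tau => (A t tau)%:C * v tau) n)) =
    zpsum (fun tau => A t tau * complex.Im (v tau)) by [].
  apply/funext => n.
  by rewrite Im_zpsum; apply: eq_zpsum => tau _; rewrite Im_realM.
have AvE : imx_mul (cplx_imx A) v = w.
  apply/funext => t; apply: complex_ext; rewrite /= /zsumR; apply: cvg_lim => //.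
    suff -> : (fun tau => complex.Re (cplx_imx A t tau * v tau)) =
      (fun tau => A t tau * complex.Re (v tau)) by exact: Re_w.
    by apply/funext => tau; rewrite Re_realM.
  suff -> : (fun tau => complex.Im (cplx_imx A t tau * v tau)) =
    (fun tau => A t tau * complex.Im (v tau)) by exact: Im_w.
  by apply/funext => tau; rewrite Im_realM.
have w2 : ell2 w.
  have /ell2P[S vS] := fourier_ell2 g2; apply/ell2P; exists (K * S + K * S) => n.
  rewrite /sqnormc zpsumD; apply: lerD.
    apply: (bounded_imx_limit _ Re_w) => k; apply: le_trans (vS k).
    by apply: le_zpsum => j; rewrite lerDl sqr_ge0.
  apply: (bounded_imx_limit _ Im_w) => k; apply: le_trans (vS k).
  by apply: le_zpsum => j; rewrite lerDr sqr_ge0.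
have [h hF] := Fstar_exists w2; exists h; first by rewrite /is_FstarAF AvE.
have [_ h2 _] := hF.
by apply: fourier_inj; [exact: L2_integrableC|exact: L2M|exact: fourier_Fstar].
Qed.

End Symbol.
End Kernels.

Theorem theorem3p1 (R : realType) (d : measure_display)
    (Omega : measurableType d) (P : probability Omega R)
    (p : nat) (hp : (1 <= p)%N)
    (X : int -> 'I_p -> Omega -> R)
    (hX : forall t a, centredL2 P (X t a))
    (hCtt : exists M : R, forall t, mx_norm (covmx P X t t) <= M)
    (hinf : (0 < lambda_inf (cov_block P X))%E)
    (hinfsup : (lambda_inf (cov_block P X) <= lambda_sup (cov_block P X))%E)
    (hsup : (lambda_sup (cov_block P X) < +oo)%E)
    (PX : int -> 'I_p -> Omega -> R)
    (beta : int -> 'I_p -> int -> 'I_p -> R)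
    (hbeta : projection_coefficients P X PX beta) :
  let D := Dblock P X PX beta in
  [/\ forall a b : 'I_p, a != b ->
        (conditionally_noncorrelated D a b <-> kernel_zero (cplx_imx (D a b))),
      forall a : 'I_p,
        (conditionally_stationary D a <-> kernel_diagonal (cplx_imx (D a a))) &
      forall a b : 'I_p, a != b ->
        (conditionally_time_invariant D a b <->
           kernel_diagonal (cplx_imx (D a b)))].
Proof.
move=> D.
have [lam lam_gt0 lam_inf] : exists2 lam : R, 0 < lam &
    (lam%:E <= lambda_inf (cov_block P X))%E.
  move: hinf; case: (lambda_inf _) => [l|_|//].
    by rewrite lte_fin => l0; exists l.
  by exists 1; rewrite ?leey.
have Db a b : bounded_imx (lam ^- 2) (D a b) by exact: Dblock_bounded.
have toeplitz a b : Toeplitz (D a b) <-> kernel_diagonal (cplx_imx (D a b)).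
  split; first exact: Toeplitz_kernel_diagonal (Db a b).
  exact: kernel_diagonal_Toeplitz.
split=> [a b _|a|a b _]; [exact: kernel_zeroP|exact: toeplitz|exact: toeplitz].
Qed.
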